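(* Let $f,g_1,\ldots,g_m\colon\mathbb{R}^n\to\mathbb{R}$ be polynomial functions with $m+1\le n$, let $$S:=\{x\in\mathbb{R}^n\mid g_1(x)\le0,\ldots,g_m(x)\le0\},\qquad \psi(x):=\max\{g_1(x),\ldots,g_m(x),0\},$$ and assume that $S\neq\emptyset$ and $\inf_{x\in S}f(x)$ is finite. Assume that the mapping $(f,g_1,\ldots,g_m)\colon\mathbb{R}^n\to\mathbb{R}^{m+1}$ is convenient and non-degenerate at infinity. Then the following properties are equivalent: (i) there exist constants $c_*>0$ and $\alpha\in(0,1]$ such that for all $c>c_*$, $$\inf_{x\in S}f(x)=\inf_{x\in\mathbb{R}^n}\left\{f(x)+c\left([\psi(x)]^\alpha+\psi(x)\right)\right\}>-\infty;$$ (ii) there exists a constant $c_*>0$ such that $\inf_{x\in\mathbb{R}^n}\{f(x)+c_*\psi(x)\}>-\infty$. When these equivalent properties hold, one has moreover (with $c_*,\alpha$ as in (i)) for all $c>c_*$ that $$\mathrm{argmin}_S f(x)=\mathrm{argmin}_{\mathbb{R}^n}\left\{f(x)+c\left([\psi(x)]^\alpha+\psi(x)\right)\right\}\ne\emptyset.$$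
   Context: Let $\mathbb{R}^*:=\mathbb{R}\setminus\{0\}$ and let $\mathbb{Z}_+$ be the set of non-negative integers. For a polynomial $h=\sum_\kappa c_\kappa x^\kappa$ on $\mathbb{R}^n$ (where $x^\kappa=x_1^{\kappa_1}\cdots x_n^{\kappa_n}$, $\kappa\in\mathbb{Z}_+^n$), its support is $\mathrm{supp}(h):=\{\kappa\mid c_\kappa\ne0\}$ and its Newton polyhedron (at infinity) $\Gamma(h)$ is the convex hull in $\mathbb{R}^n$ of $\mathrm{supp}(h)$. The polynomial $h$ is convenient if $\Gamma(h)$ intersects each coordinate axis at a point different from the origin. For $q\in\mathbb{R}^n$ put $$d(q,\Gamma):=\min\{\langle q,\kappa\rangle\mid\kappa\in\Gamma\},\qquad \Delta(q,\Gamma):=\{\kappa\in\Gamma\mid\langle q,\kappa\rangle=d(q,\Gamma)\},$$ and for a face $\Delta$ of $\Gamma(h)$ put $h_\Delta(x):=\sum_{\kappa\in\Delta}c_\kappa x^\kappa$. Let $F=(f_1,\ldots,f_p)\colon\mathbb{R}^n\to\mathbb{R}^p$, $1\le p\le n$, be a polynomial mapping. $F$ is convenient if all $f_i$ are convenient. $F$ is Khovanskii non-degenerate at infinity if for any $q\in\mathbb{R}^n$ with $d(q,\Gamma(f_i))<0$ for $i=1,\ldots,p$, there are no $x\in(\mathbb{R}^* )^n$ and $\lambda\in(\mathbb{R}^* )^p$ such that $f_{i,\Delta_i}(x)=0$ for $i=1,\ldots,p$ and $\sum_{i=1}^p\lambda_i\nabla f_{i,\Delta_i}(x)=0$, where $\Delta_i:=\Delta(q,\Gamma(f_i))$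 and $f_{i,\Delta_i}:=(f_i)_{\Delta_i}$. $F$ is non-degenerate at infinity if for each $k$-tuple $1\le i_1<\cdots<i_k\le p$ the mapping $(f_{i_1},\ldots,f_{i_k})\colon\mathbb{R}^n\to\mathbb{R}^k$ is Khovanskii non-degenerate at infinity. $\mathrm{argmin}$ denotes the set of global minimizers on the indicated set. *)

(* Defs.v *)
(* MathComp-Analysis, with polynomials from multinomials.  The notations of
   mpoly are not imported because they clash with those of MathComp-Analysis. *)
From HB Require Import structures.
From mathcomp Require Import all_boot all_order all_algebra.
From mathcomp Require Import all_classical all_reals all_analysis.
From mathcomp Require Import -(notations) mpoly.

Set Implicit Arguments.
Unset Strict Implicit.
Unset Printing Implicit Defensive.

Import Order.TTheory GRing.Theory Num.Theory.
Local Open Scope classical_set_scope.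
Local Open Scope ring_scope.

Definition pfun (R : realType) (n : nat) (h : mpoly n R) (x : 'rV[R]_n) : R :=
  meval (x ord0) h.

Definition gradient (R : realType) (n : nat) (h : mpoly n R) (x : 'rV[R]_n) :
  'rV[R]_n := \row_j pfun (mderiv j h) x.

Definition inner (R : realType) (n : nat) (x y : 'rV[R]_n) : R :=
  \sum_(i < n) x ord0 i * y ord0 i.

Definition exponent (R : realType) (n : nat) (k : multinom n) : 'rV[R]_n :=
  \row_(i < n) (k i)%:R.

Definition convex_hull (R : realType) (n : nat) (A : set 'rV[R]_n) :
  set 'rV[R]_n := smallest (fun B : set 'rV[R]_n => convex_set B) A.

Definition newton (R : realType) (n : nat) (h : mpoly n R) : set 'rV[R]_n :=
  convex_hull [set exponent R k | k in [set k | k \in msupp h]].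

(* d(q, G).  When G is the Newton polyhedron of a nonzero polynomial, G is a
   nonempty polytope and this infimum is a minimum. *)
Definition face_val (R : realType) (n : nat) (q : 'rV[R]_n)
    (G : set 'rV[R]_n) : R :=
  inf [set inner q k | k in G].

Definition face (R : realType) (n : nat) (q : 'rV[R]_n)
    (G : set 'rV[R]_n) : set 'rV[R]_n :=
  [set k | G k /\ inner q k = face_val q G].

Definition restr (R : realType) (n : nat) (h : mpoly n R)
    (D : set 'rV[R]_n) : mpoly n R :=
  \sum_(k <- msupp h | exponent R k \in D) mcoeff k h *: mpolyX R k.

Definition convenient_poly (R : realType) (n : nat) (h : mpoly n R) : Prop :=
  forall i : 'I_n, exists2 t : R, t != 0 & newton h (t *: delta_mx ord0 i).

Definition convenient (R : realType) (n p : nat) (F : 'I_p -> mpoly n R) :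
  Prop := forall i, convenient_poly (F i).

Definition khovanskii_nondegenerate_at_infinity (R : realType) (n p : nat)
    (F : 'I_p -> mpoly n R) : Prop :=
  forall q : 'rV[R]_n,
    (forall i, face_val q (newton (F i)) < 0) ->
    let FD i := restr (F i) (face q (newton (F i))) in
    ~ exists (x : 'rV[R]_n) (lambda : 'I_p -> R),
        [/\ forall j, x ord0 j != 0,
            forall i, lambda i != 0,
            forall i, pfun (FD i) x = 0
          & \sum_(i < p) lambda i *: gradient (FD i) x = 0].

(* A k-tuple i_1 < ... < i_k is a strictly increasing s : 'I_k -> 'I_p.  The
   hypothesis 0 < k matters: the empty family is never Khovanskii
   nondegenerate, because the empty sum of gradients is 0. *)
Definition nondegenerate_at_infinity (R : realType) (n p : nat)
    (F : 'I_p -> mpoly n R) : Prop :=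
  forall (k : nat) (s : 'I_k -> 'I_p), (0 < k)%N ->
    {homo s : i j / (i < j)%N} ->
    khovanskii_nondegenerate_at_infinity (fun i => F (s i)).

(* (f, g_1, ..., g_m) *)
Definition fcons (T : Type) (m : nat) (f : T) (g : 'I_m -> T) (i : 'I_m.+1) : T :=
  if unlift ord0 i is Some j then g j else f.

Definition feasible (R : realType) (n m : nat) (g : 'I_m -> mpoly n R) :
  set 'rV[R]_n := [set x | forall i, pfun (g i) x <= 0].

Definition violation (R : realType) (n m : nat) (g : 'I_m -> mpoly n R)
    (x : 'rV[R]_n) : R :=
  \big[Num.max/0]_(i < m) pfun (g i) x.

Definition penalized (R : realType) (n m : nat) (f : mpoly n R)
    (g : 'I_m -> mpoly n R) (c alpha : R) (x : 'rV[R]_n) : R :=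
  pfun f x + c * (violation g x `^ alpha + violation g x).

Definition einf (R : realType) (T : Type) (D : set T) (phi : T -> R) : \bar R :=
  ereal_inf [set (phi x)%:E | x in D].

Definition argmin (R : realType) (T : Type) (D : set T) (phi : T -> R) : set T :=
  [set x | D x /\ forall y, D y -> phi x <= phi y].

Definition exact_penalty (R : realType) (n m : nat) (f : mpoly n R)
    (g : 'I_m -> mpoly n R) (cstar alpha : R) : Prop :=
  [/\ 0 < cstar, 0 < alpha, alpha <= 1
    & forall c : R, cstar < c ->
        einf (feasible g) (pfun f) = einf setT (penalized f g c alpha) /\
        (-oo < einf setT (penalized f g c alpha))%E].

(* Main.v *)
Require Import Defs.
From HB Require Import structures.
From mathcomp Require Import all_boot all_order all_algebra.
From mathcomp Require Import all_classical all_reals all_analysis.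
From mathcomp Require Import -(notations) mpoly.
From mathcomp Require ordered_qelim qe_rcf.
From mathcomp Require Import ring lra.

Set Implicit Arguments.
Unset Strict Implicit.
Unset Printing Implicit Defensive.

Import Order.TTheory GRing.Theory Num.Theory.
Import numFieldNormedType.Exports.
Local Open Scope classical_set_scope.
Local Open Scope ring_scope.

(** Let [r] be the infimum of [f] on the feasible set [S].  Everything rests on
    one property of a convenient nondegenerate family [F]: if the system
    [F_i <= c_i] can be solved up to every error [d > 0], then it can be solved
    exactly ([sublevel_attained]).  With the bound [r] on [f] this says that [f]
    attains [r] on [S]; with a bound below [r] it says that the infimum of [f]
    over [psi <= t] tends to [r] when [t] tends to [0].

    To prove this property, suppose that there is no exact solution.  Minimizing
    the norm of the vector of excesses [max (F_i - c_i, 0)], plus a small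
    multiple of [|x|^2], produces points [x] that tend to infinity, with weights
    [lambda], at which every [x_j * sum_i lambda_i d_j F_i (x)] stays bounded,
    and so does [F_i (x)] whenever [lambda_i > 0]
    ([critical_points_at_infinity]).  Nondegeneracy excludes such points
    ([no_critical_sequence]) by a compactness argument in logarithmic
    coordinates, carried out along an ultrafilter.  For each [i] let [M_i] be,
    up to a bounded factor, the size of the largest monomial of [F_i] at [x];
    some monomials of [F_i] are comparable with [M_i], the others are
    negligible.  The vector of logarithms [ln |x_j|] is a bounded vector plus a
    vector [u] on which comparable monomials take the same value.  The covector
    [-u] then selects exactly the dominant monomials, that is a face [Delta_i]
    of each Newton polyhedron, and the exponential of the limit of the bounded
    part is a point [y] of the torus such that [F_i / M_i] and [x_j d_j F_i / M_i]
    tend to the values at [y] of the restriction of [F_i] to [Delta_i] and of its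
    logarithmic derivative ([tropical_limit]).  Convenience makes [M_i] tend to
    infinity, so that division by [sum_i lambda_i M_i] turns the two bounds above
    into the relations that nondegeneracy forbids for the subfamily of those [i]
    whose weight survives in the limit.

    The exponent comes from the theorem of Tarski and Seidenberg.  The set of
    all [(t, s)] such that [psi <= t] and [f <= r - s] have a common solution is
    defined by sign conditions on finitely many polynomials in [t] and [s].
    Above a small [t], the upper end [s] of this set is a zero of one of them,
    and it tends to [0] with [t]; hence [s ^ N <= C * t] ([holder_sublevel]).
    This bounds [r - f] by a multiple of [psi ^ (1 / N)] where [psi] is small,
    and (ii) bounds it by a multiple of [psi] elsewhere: together they give (i).
    The converse is [psi ^ alpha <= 1 + psi].  For the minimizers, a minimizer of
    the penalized function for [c] has [psi = 0], because otherwise a smaller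
    constant would give a value below [r]. *)

(** * Monomials, logarithmic derivatives and minima of polynomials *)

Definition monomial (R : realType) (n : nat) (x : 'rV[R]_n) (k : multinom n) : R :=
  \prod_i x ord0 i ^+ k i.

Lemma pfun_sum (R : realType) (n : nat) (s : seq (multinom n))
    (P : pred (multinom n)) (c : multinom n -> R) (x : 'rV[R]_n) :
  pfun (\sum_(k <- s | P k) c k *: mpolyX R k) x =
  \sum_(k <- s | P k) c k * monomial x k.
Proof.
rewrite /pfun raddf_sum /=; apply: eq_bigr => k _.
by rewrite mevalZ mevalX.
Qed.

(** The logarithmic derivative [x_j d_j] is diagonal on monomials, so that it
    involves the same monomials as the polynomial itself and has the same
    asymptotics. *)
Lemma mul_pfun_mderiv_sum (R : realType) (n : nat) (s : seq (multinom n))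
    (P : pred (multinom n)) (c : multinom n -> R) (x : 'rV[R]_n) (j : 'I_n) :
  x ord0 j * pfun (mderiv j (\sum_(k <- s | P k) c k *: mpolyX R k)) x =
  \sum_(k <- s | P k) c k * (k j)%:R * monomial x k.
Proof.
rewrite /pfun (linear_sum (mderiv j)) raddf_sum mulr_sumr /=; apply: eq_bigr => k _.
rewrite mderivZ mderivX !mevalZ mevalX.
have [->|kj_gt0] := posnP (k j); first by rewrite !(mul0r, mulr0).
rewrite -mulrA mulrCA; congr (_ * _); rewrite mulrCA; congr (_ * _).
rewrite /monomial (bigD1 j) //= [RHS](bigD1 j) //= mulrA -exprS.
rewrite mnmBE mnm1E eqxx subn1 prednK //.
congr (_ * _); apply: eq_bigr => i ij.
by rewrite mnmBE mnm1E eq_sym (negbTE ij) subn0.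
Qed.

Lemma pfunE (R : realType) (n : nat) (h : mpoly n R) (x : 'rV[R]_n) :
  pfun h x = \sum_(k <- msupp h) mcoeff k h * monomial x k.
Proof. by rewrite /pfun mevalE. Qed.

Lemma mul_pfun_mderiv (R : realType) (n : nat) (h : mpoly n R) (x : 'rV[R]_n)
    (j : 'I_n) :
  x ord0 j * pfun (mderiv j h) x =
  \sum_(k <- msupp h) mcoeff k h * (k j)%:R * monomial x k.
Proof. by rewrite {1}[h]mpolyE mul_pfun_mderiv_sum. Qed.

Lemma pfunD (R : realType) (n : nat) (x : 'rV[R]_n) (g h : mpoly n R) :
  pfun (g + h) x = pfun g x + pfun h x.
Proof. exact: mevalD. Qed.

Lemma deriv_eq0_at_min (R : realType) (p : {poly R}) (a : R) :
  (forall t, p.[a] <= p.[t]) -> p^`().[a] = 0.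
Proof.
move=> pmin.
suff : is_derive (a : R^o) (1 : R^o) (horner p : R^o -> R^o) 0.
  by case=> _; rewrite -derive1E derivE.
apply: (@derive1_at_min R (horner p) (a - 1) (a + 1)); first lra.
- by move=> t _; exact: derivable_horner.
- by rewrite in_itv /=; apply/andP; split; lra.
- by move=> t _.
Qed.

(** On the line through [x] parallel to the [j]-th axis, [h] is a univariate
    polynomial of the [j]-th coordinate, with derivative [mderiv j h]. *)
Lemma pfun_mderiv_eq0_at_min (R : realType) (n : nat) (h : mpoly n R)
    (x : 'rV[R]_n) (j : 'I_n) :
  (forall y, pfun h x <= pfun h y) -> pfun (mderiv j h) x = 0.
Proof.
move=> hmin.
pose p : {poly R} := \sum_(k <- msupp h)
  (mcoeff k h * \prod_(i | i != j) x ord0 i ^+ k i) *: 'X^(k j).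
pose xt t : 'rV[R]_n := \row_i (if i == j then t else x ord0 i).
have ptE t : p.[t] = pfun h (xt t).
  rewrite pfunE horner_sum; apply: eq_bigr => k _; rewrite /monomial.
  rewrite hornerZ hornerXn [in RHS](bigD1 j) //= [xt t ord0 j]mxE eqxx -mulrA.
  congr (_ * _); rewrite mulrC; congr (_ * _).
  by apply: eq_bigr => i /negbTE ij; rewrite mxE ij.
have xx : xt (x ord0 j) = x.
  by apply/rowP => i; rewrite mxE; case: eqP => // ->.
have := @deriv_eq0_at_min R p (x ord0 j).
rewrite ptE xx => /(_ (fun t => eq_ind_r (fun z => _ <= z) (hmin (xt t)) (ptE t))) <-.
rewrite /p [in RHS]raddf_sum horner_sum.
rewrite [in LHS](mpolyE h) /pfun (linear_sum (mderiv j)) raddf_sum.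
apply: eq_bigr => k _.
rewrite /= derivZ derivXn mderivZ mderivX !mevalZ mevalX hornerZ hornerMn hornerXn.
rewrite -mulrA; congr (_ * _).
rewrite (bigD1 j) //= mnmBE mnm1E eqxx subn1 mulrA mulr_natl [RHS]mulrC.
congr (_ * _).
by apply: eq_bigr => i ij; rewrite mnmBE mnm1E eq_sym (negbTE ij) subn0.
Qed.

(** * Minima of continuous functions on R^n *)

Lemma continuous_bigsum (R : realType) (n : nat) (I : Type) (r : seq I)
    (P : pred I) (f : I -> 'rV[R]_n -> R) :
  (forall i, continuous (f i)) -> continuous (fun x => \sum_(i <- r | P i) f i x).
Proof.
move=> fc; elim: r => [|i r ih] x.
  by under eq_fun do rewrite big_nil; exact: cst_continuous.
under eq_fun do rewrite big_cons.
by case: (P i); [exact: (cvgD (fc i x) (ih x))|exact: ih].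
Qed.

Lemma continuous_bigprod (R : realType) (n : nat) (I : Type) (r : seq I)
    (f : I -> 'rV[R]_n -> R) :
  (forall i, continuous (f i)) -> continuous (fun x => \prod_(i <- r) f i x).
Proof.
move=> fc; elim: r => [|i r ih] x.
  by under eq_fun do rewrite big_nil; exact: cst_continuous.
under eq_fun do rewrite big_cons.
exact: (cvgM (fc i x) (ih x)).
Qed.

Lemma continuous_expn (R : realType) (n k : nat) (f : 'rV[R]_n -> R) :
  continuous f -> continuous (fun x => f x ^+ k).
Proof.
move=> fc x; elim: k => [|k ih].
  by under eq_fun do rewrite expr0; exact: cst_continuous.
under eq_fun do rewrite exprS.
exact: (cvgM (fc x) ih).
Qed.

Lemma continuous_pfun (R : realType) (n : nat) (h : mpoly n R) :
  continuous (@pfun R n h).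
Proof.
rewrite (_ : pfun h = fun x => \sum_(k <- msupp h)
    mcoeff k h * monomial x k); last exact/funext/pfunE.
apply: continuous_bigsum => k x; apply: continuousM; first exact: cst_continuous.
by apply: continuous_bigprod => i; apply: continuous_expn; exact: coord_continuous.
Qed.

Definition sqnorm (R : realType) (n : nat) (x : 'rV[R]_n) : R :=
  \sum_i x ord0 i ^+ 2.

Lemma sqnorm_ge0 (R : realType) (n : nat) (x : 'rV[R]_n) : 0 <= sqnorm x.
Proof. by apply: sumr_ge0 => i _; exact: sqr_ge0. Qed.

Lemma le_sqnorm (R : realType) (n : nat) (x : 'rV[R]_n) j :
  x ord0 j ^+ 2 <= sqnorm x.
Proof.
by rewrite /sqnorm (bigD1 j) //= lerDl sumr_ge0 // => i _; exact: sqr_ge0.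
Qed.

Lemma sqnorm0 (R : realType) (n : nat) : sqnorm (0 : 'rV[R]_n) = 0.
Proof. by rewrite /sqnorm big1 // => i _; rewrite mxE expr0n. Qed.

Lemma continuous_sqnorm (R : realType) (n : nat) : continuous (@sqnorm R n).
Proof.
by apply: continuous_bigsum => i; apply: continuous_expn; exact: coord_continuous.
Qed.

Lemma compact_sqnorm_ball (R : realType) (n : nat) (N : R) :
  compact [set x : 'rV[R]_n | sqnorm x <= N].
Proof.
apply: bounded_closed_compact; last first.
  exact: (closed_comp (fun x _ => @continuous_sqnorm R n x) (@closed_le R N)).
exists (1 + N); split; first exact: num_real.
move=> M NM x /= xN.
have N0 : 0 <= N := le_trans (sqnorm_ge0 x) xN.
rewrite [leLHS]/Num.Def.normr/= mx_normrE; apply/bigmax_leP; split; first by lra.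
move=> [a b] _ /=; rewrite (ord1 a).
have := le_trans (le_sqnorm x b) xN; rewrite -real_normK ?num_real //.
have := normr_ge0 (x ord0 b); set z := `|_| => z0 zN.
nra.
Qed.

Lemma ex_min_sqnorm_ball (R : realType) (n : nat) (N : R) (G : 'rV[R]_n -> R) :
  0 <= N -> continuous G ->
  exists2 x, sqnorm x <= N & forall y, sqnorm y <= N -> G x <= G y.
Proof.
move=> N0 Gc.
have [||x] := @EVT_min_rV R n G _ _ (@compact_sqnorm_ball R n N).
- by exists 0 => /=; rewrite sqnorm0.
- exact: continuous_subspaceT.
rewrite inE /= => xN xmin; exists x => // y yN.
by apply: xmin; rewrite inE.
Qed.

(** The term [eps * sqnorm x] exceeds [G 0] outside of a ball, so that a minimum
    on this ball is global. *)
Lemma ex_min_regularized (R : realType) (n : nat) (eps : R) (G : 'rV[R]_n -> R) :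
  0 < eps -> continuous G -> (forall x, 0 <= G x) ->
  exists x, forall y, G x + eps * sqnorm x <= G y + eps * sqnorm y.
Proof.
move=> eps0 Gc G0.
have Hc : continuous (fun x : 'rV[R]_n => G x + eps * sqnorm x).
  move=> x; apply: (cvgD (Gc x)); apply: (@continuousM R _ (fun=> eps)).
    exact: cst_continuous.
  exact: continuous_sqnorm.
have [|x xN xmin] := ex_min_sqnorm_ball (N := G 0 / eps) _ Hc.
  by rewrite divr_ge0 // ltW.
exists x => y; have [/xmin//|yN] := leP (sqnorm y) (G 0 / eps).
have /xmin : sqnorm (0 : 'rV[R]_n) <= G 0 / eps by rewrite sqnorm0 divr_ge0 // ltW.
rewrite sqnorm0 mulr0 addr0 => /le_trans; apply.
by move: yN; rewrite ltr_pdivrMr // mulrC => /ltW h; rewrite (le_trans h) // lerDr.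
Qed.

(** * Critical points at infinity of an unsolvable system *)

Definition excess (R : realType) (n p : nat) (F : 'I_p -> mpoly n R)
    (c : 'I_p -> R) (i : 'I_p) (x : 'rV[R]_n) : R :=
  Num.max (pfun (F i) x - c i) 0.

Definition excess_norm (R : realType) (n p : nat) (F : 'I_p -> mpoly n R)
    (c : 'I_p -> R) (x : 'rV[R]_n) : R :=
  Num.sqrt (\sum_i excess F c i x ^+ 2).

Lemma excess_ge0 (R : realType) (n p : nat) (F : 'I_p -> mpoly n R)
    (c : 'I_p -> R) i x : 0 <= excess F c i x.
Proof. by rewrite /excess le_max lexx orbT. Qed.

Lemma excess_norm_ge0 (R : realType) (n p : nat) (F : 'I_p -> mpoly n R)
    (c : 'I_p -> R) x : 0 <= excess_norm F c x.
Proof. exact: sqrtr_ge0. Qed.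

Lemma sqr_excess_norm (R : realType) (n p : nat) (F : 'I_p -> mpoly n R)
    (c : 'I_p -> R) x :
  excess_norm F c x ^+ 2 = \sum_i excess F c i x ^+ 2.
Proof. by rewrite sqr_sqrtr // sumr_ge0 // => i _; exact: sqr_ge0. Qed.

Lemma excess_le_norm (R : realType) (n p : nat) (F : 'I_p -> mpoly n R)
    (c : 'I_p -> R) i x : excess F c i x <= excess_norm F c x.
Proof.
rewrite -ler_sqr ?nnegrE ?excess_ge0 ?excess_norm_ge0 // sqr_excess_norm.
by rewrite (bigD1 i) //= lerDl sumr_ge0 // => j _; exact: sqr_ge0.
Qed.

Lemma excess_norm_gt0 (R : realType) (n p : nat) (F : 'I_p -> mpoly n R)
    (c : 'I_p -> R) x :
  (exists i, c i < pfun (F i) x) -> 0 < excess_norm F c x.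
Proof.
move=> [i ci]; apply: lt_le_trans (excess_le_norm F c i x).
by rewrite /excess lt_max subr_gt0 ci.
Qed.

Lemma excess_norm_le (R : realType) (n p : nat) (F : 'I_p -> mpoly n R)
    (c : 'I_p -> R) x (d : R) : 0 <= d ->
  (forall i, pfun (F i) x <= c i + d) -> excess_norm F c x <= p.+1%:R * d.
Proof.
move=> d0 Fd.
rewrite -ler_sqr ?nnegrE ?excess_norm_ge0 ?mulr_ge0 // sqr_excess_norm.
apply: (@le_trans _ _ (\sum_(i < p) d ^+ 2)).
  apply: ler_sum => i _; rewrite ler_sqr ?nnegrE ?excess_ge0 //.
  by rewrite /excess ge_max d0 andbT lerBlDl.
rewrite sumr_const card_ord exprMn -[leLHS]mulr_natl.
apply: ler_wpM2r; first exact: sqr_ge0.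
by rewrite -natrX ler_nat (leq_trans (leqnSn p)) // leq_pmulr.
Qed.

Lemma continuous_excess_norm (R : realType) (n p : nat) (F : 'I_p -> mpoly n R)
    (c : 'I_p -> R) : continuous (excess_norm F c).
Proof.
have sc : continuous (fun x => \sum_i excess F c i x ^+ 2).
  apply: continuous_bigsum => i; apply: continuous_expn => x.
  apply: (@continuous_max R _ (fun x => pfun (F i) x - c i) (fun=> 0)).
    apply: (@continuousB R _ _ (pfun (F i)) (fun=> c i)).
      exact: continuous_pfun.
    exact: cst_continuous.
  exact: cst_continuous.
move=> x; apply: continuous_comp; first exact: sc.
exact: sqrt_continuous.
Qed.

(** The norm of the excesses need not be differentiable.  Near the minimizer [x]
    it is replaced by a polynomial that lies above it and agrees with it at [x]:
    [sqrt a <= (a / r + r) / 2] removes the square root, and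
    [max (h, 0) ^ 2 <= (h - b) ^ 2] with [b = min (h (x), 0)] removes the
    maximum.  The gradient of this polynomial vanishes at [x]. *)
Lemma critical_point_excess_norm (R : realType) (n p : nat) (F : 'I_p -> mpoly n R)
    (c : 'I_p -> R) (eps : R) (x : 'rV[R]_n) :
  0 < eps -> (exists i, c i < pfun (F i) x) ->
  (forall y, excess_norm F c x + eps * sqnorm x <=
             excess_norm F c y + eps * sqnorm y) ->
  forall j, \sum_i excess F c i x * (x ord0 j * pfun (mderiv j (F i)) x) =
    - (2 * eps * excess_norm F c x * x ord0 j ^+ 2).
Proof.
move=> eps0 /excess_norm_gt0 r0 xmin j.
set r := excess_norm F c x in r0 xmin *.
pose b i := Num.min (pfun (F i) x - c i) 0.
have exE i : excess F c i x = pfun (F i) x - c i - b i.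
  rewrite /excess /b; case: leP; lra.
pose P : mpoly n R := \sum_i (F i - mpolyC n (c i + b i)) ^+ 2
   + mpolyC n (2 * r * eps) * \sum_i (mpolyX R (mnm1 i)) ^+ 2.
have PE y : pfun P y = \sum_i (pfun (F i) y - c i - b i) ^+ 2
    + 2 * r * eps * sqnorm y.
  rewrite pfunD; congr (_ + _).
    rewrite /pfun raddf_sum; apply: eq_bigr => i _ /=.
    by rewrite !expr2 mevalM mevalB mevalC opprD addrA.
  rewrite /pfun mevalM mevalC raddf_sum; congr (_ * _); apply: eq_bigr => i _ /=.
  by rewrite !expr2 mevalM mevalXU.
have Pmin y : pfun P x <= pfun P y.
  rewrite !PE.
  rewrite (eq_bigr (fun i => excess F c i x ^+ 2)); last by move=> i _; rewrite exE.
  rewrite -sqr_excess_norm -/r.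
  apply: (@le_trans _ _ (excess_norm F c y ^+ 2 + 2 * r * eps * sqnorm y)).
    have := xmin y; set ry := excess_norm F c y => h.
    have h2 : 0 <= (ry - r) ^+ 2 by exact: sqr_ge0.
    have := ler_wpM2l (ltW r0) h; nra.
  rewrite lerD2r sqr_excess_norm; apply: ler_sum => i _.
  rewrite -[leRHS]real_normK ?num_real // ler_sqr ?nnegrE ?excess_ge0 //.
  have bi : b i <= 0 by rewrite /b ge_min lexx orbT.
  rewrite /excess ge_max normr_ge0 andbT.
  by apply: le_trans (ler_norm _); rewrite lerDl oppr_ge0.
have := pfun_mderiv_eq0_at_min j Pmin.
have -> : pfun (mderiv j P) x =
    2 * (\sum_i excess F c i x * pfun (mderiv j (F i)) x)
    + 2 * r * eps * (2 * x ord0 j).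
  rewrite /P mderivD pfunD; congr (_ + _).
    rewrite (linear_sum (mderiv j)) /pfun raddf_sum mulr_sumr.
    apply: eq_bigr => i _ /=.
    rewrite expr2 mderivM mevalD !mevalM mderivB mderivC subr0 mevalB mevalC.
    rewrite exE /pfun; ring.
  rewrite mderivM mderivC mul0r add0r (linear_sum (mderiv j)) /pfun mevalM mevalC.
  congr (_ * _); rewrite raddf_sum (bigD1 j) //= big1.
    rewrite expr2 mderivM mderivX mnm1E eqxx scale1r mevalD !mevalM !mevalXU.
    rewrite mevalX big1 => [|i _]; last by rewrite mnmBE subnn expr0.
    by rewrite mul1r mulr1 addr0 mulr_natl mulr2n.
  move=> i ij; rewrite expr2 mderivM mderivX mnm1E (negbTE ij) scale0r.
  by rewrite mul0r mulr0 addr0 meval0.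
move=> /(congr1 (fun z => x ord0 j * z)); rewrite mulr0 => grad0.
rewrite (eq_bigr (fun i => x ord0 j * (excess F c i x * pfun (mderiv j (F i)) x)));
  last by move=> i _; rewrite mulrCA.
rewrite -mulr_sumr; move: grad0; lra.
Qed.

(** The minimizers of the regularized norm of the excesses tend to infinity,
    because this norm is bounded below by a positive constant on every ball and
    takes arbitrarily small values.  The same comparison bounds [eps * sqnorm x],
    hence the gradient of the regularization after multiplication by [x_j]. *)
Lemma critical_points_at_infinity (R : realType) (n p : nat)
    (F : 'I_p -> mpoly n R) (c : 'I_p -> R) :
  (forall d, 0 < d -> exists x, forall i, pfun (F i) x <= c i + d) ->
  (forall x, exists i, c i < pfun (F i) x) ->
  forall N : R, exists (x : 'rV[R]_n) (lambda : 'I_p -> R),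
    [/\ N < sqnorm x,
        forall i, 0 <= lambda i,
        \sum_i lambda i ^+ 2 = 1,
        forall i, 0 < lambda i -> `|pfun (F i) x| <= `|c i| + 1
      & forall j, `|\sum_i lambda i * (x ord0 j * pfun (mderiv j (F i)) x)| <= 1].
Proof.
move=> inf0 nosol N; wlog N0 : N / 0 <= N.
  move=> hw; have [/hw//|N0] := leP 0 N.
  have [x [lambda [Nx *]]] := hw 0 (lexx 0); exists x, lambda; split => //.
  exact: lt_trans N0 Nx.
have [x0 _ x0min] := ex_min_sqnorm_ball N0 (@continuous_excess_norm R n p F c).
have m0 := excess_norm_gt0 (nosol x0).
set m := excess_norm F c x0 in x0min m0 *.
(* Minimizers whose value is at most [eta < m] lie outside of the ball. *)
pose eta := Num.min m 1 / 2.
have min0 : 0 < Num.min m 1 by rewrite lt_min m0 ltr01.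
have etam : eta < m by have := ge_min m m 1; rewrite lexx /eta /=; lra.
have eta2 : eta <= 1 / 2 by have := ge_min 1 m 1; rewrite lexx orbT /eta /=; lra.
have eta0 : 0 < eta by rewrite /eta; lra.
have [|z zF] := inf0 (eta / 2 / p.+1%:R); first by rewrite !divr_gt0.
have rz : excess_norm F c z <= eta / 2.
  have d0 : 0 <= eta / 2 / p.+1%:R by rewrite !divr_ge0 // ltW.
  by have := excess_norm_le d0 zF; rewrite mulrC divfK.
pose eps := eta / 2 / (sqnorm z + 1).
have z1 : 0 < sqnorm z + 1 by have := sqnorm_ge0 z; lra.
have eps0 : 0 < eps by rewrite !divr_gt0.
have epsz : eps * sqnorm z <= eta / 2.
  by rewrite /eps mulrAC ler_pdivrMr // ler_pM2l ?divr_gt0 // lerDl.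
have [x xmin] := ex_min_regularized eps0 (@continuous_excess_norm R n p F c)
  (excess_norm_ge0 F c).
have xsmall : excess_norm F c x + eps * sqnorm x <= eta.
  by apply: le_trans (xmin z) _; lra.
have r0 := excess_norm_gt0 (nosol x).
have crit := critical_point_excess_norm eps0 (nosol x) xmin.
set r := excess_norm F c x in r0 xmin xsmall crit *.
have epsx : 0 <= eps * sqnorm x by rewrite mulr_ge0 ?sqnorm_ge0 // ltW.
exists x, (fun i => excess F c i x / r); split.
- by rewrite ltNge; apply/negP => /x0min; rewrite -/r; lra.
- by move=> i; rewrite divr_ge0 ?excess_ge0 // ltW.
- under eq_bigr do rewrite expr_div_n.
  by rewrite -mulr_suml -sqr_excess_norm -/r divff // expf_neq0 // gt_eqF.
- move=> i; rewrite pmulr_lgt0 ?invr_gt0 // => ex0.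
  have exE : excess F c i x = pfun (F i) x - c i.
    by move: ex0; rewrite /excess lt_max ltxx orbF => /ltW/max_l.
  have : excess F c i x <= 1.
    by apply: le_trans (excess_le_norm F c i x) _; rewrite -/r; lra.
  rewrite (_ : pfun (F i) x = c i + excess F c i x); last by rewrite exE; lra.
  by move=> ex1; rewrite (le_trans (ler_normD _ _)) // lerD2l gtr0_norm.
- move=> j; rewrite (eq_bigr (fun i => r^-1 *
    (excess F c i x * (x ord0 j * pfun (mderiv j (F i)) x)))); last first.
    by move=> i _; rewrite [RHS]mulrCA -!mulrA.
  rewrite -mulr_sumr crit.
  rewrite (_ : _ * _ = - (2 * (eps * x ord0 j ^+ 2))); last by field; rewrite gt_eqF.
  have xj0 := sqr_ge0 (x ord0 j).
  have epsj : 0 <= eps * x ord0 j ^+ 2 by apply: mulr_ge0 => //; exact: ltW.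
  rewrite normrN ger0_norm; last by lra.
  have := ler_wpM2l (ltW eps0) (le_sqnorm x j); lra.
Qed.

(** * Newton polyhedra *)

Lemma innerDr (R : realType) (n : nat) (q x y : 'rV[R]_n) :
  inner q (x + y) = inner q x + inner q y.
Proof. by rewrite -big_split /=; apply: eq_bigr => i _; rewrite mxE mulrDr. Qed.

Lemma innerZr (R : realType) (n : nat) (q x : 'rV[R]_n) (a : R) :
  inner q (a *: x) = a * inner q x.
Proof. by rewrite mulr_sumr; apply: eq_bigr => i _; rewrite mxE mulrCA. Qed.

(** A half-space is convex, so that it contains the hull of the support as soon
    as it contains the support. *)
Lemma newton_halfspace (R : realType) (n : nat) (h : mpoly n R)
    (q : 'rV[R]_n) (d : R) :
  (forall k, k \in msupp h -> d <= inner q (exponent R k)) ->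
  forall z, newton h z -> d <= inner q z.
Proof.
move=> hd z hz; apply: (hz [set z | d <= inner q z]); split; last first.
  by move=> _ [k kh <-] /=; exact: hd.
move=> x y l; rewrite !inE /= => dx dy.
change (d <= inner q (l%:num *: (x : 'rV[R]_n) + (1 - l%:num) *: (y : 'rV[R]_n))).
have l0 : 0 <= l%:num by [].
have l1 : l%:num <= 1 by [].
rewrite innerDr !innerZr; nra.
Qed.

Lemma newton_exponent (R : realType) (n : nat) (h : mpoly n R) k :
  k \in msupp h -> newton h (exponent R k).
Proof. by move=> kh B [_]; apply; exists k. Qed.

Lemma face_val_newton (R : realType) (n : nat) (h : mpoly n R)
    (q : 'rV[R]_n) k : k \in msupp h ->
  (forall l, l \in msupp h -> inner q (exponent R k) <= inner q (exponent R l)) ->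
  face_val q (newton h) = inner q (exponent R k).
Proof.
move=> kh kmin; have lb := newton_halfspace kmin.
rewrite /face_val; apply/eqP; rewrite eq_le; apply/andP; split.
  apply: inf_lbound; last by exists (exponent R k) => //; exact: newton_exponent.
  by exists (inner q (exponent R k)) => _ [z hz <-]; exact: lb.
apply: lb_le_inf; last by move=> _ [z hz <-]; exact: lb.
by exists (inner q (exponent R k)), (exponent R k) => //; exact: newton_exponent.
Qed.

(** If every nonconstant monomial of [h] involved another variable than [x_j],
    the Newton polyhedron would lie in [0 <= z_j <= K * sum_(l != j) z_l], which
    meets the [j]-th axis only at the origin. *)
Lemma convenient_pure_power (R : realType) (n : nat) (h : mpoly n R) :
  convenient_poly h -> forall j, exists k,
  [/\ k \in msupp h, (0 < k j)%N & forall i, i != j -> k i = 0%N].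
Proof.
move=> hconv j; apply: contrapT => nopure; have [t t0 ht] := hconv j.
have tE q : inner q (t *: delta_mx ord0 j) = t * q ord0 j.
  rewrite innerZr; congr (_ * _); rewrite /inner (bigD1 j) //= mxE !eqxx mulr1.
  by rewrite big1 ?addr0 // => i /negbTE ij; rewrite mxE ij andbF mulr0.
have t_ge0 : 0 <= t.
  have := @newton_halfspace _ _ h (delta_mx ord0 j) 0 _ _ ht.
  rewrite tE mxE !eqxx mulr1; apply => k _.
  by apply: sumr_ge0 => i _; rewrite !mxE mulr_ge0.
pose K : R := \sum_(k <- msupp h) (k j)%:R.
have kK k : k \in msupp h -> (k j)%:R <= K.
  by move=> kh; rewrite /K (big_rem k) //= lerDl sumr_ge0.
pose b : 'rV[R]_n := \row_i (if i == j then -1 else K).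
have : 0 <= t * b ord0 j.
  rewrite -tE; apply: newton_halfspace ht => k kh.
  rewrite /inner (bigD1 j) //= !mxE eqxx mulN1r addrC subr_ge0.
  have K0 : 0 <= K by rewrite sumr_ge0.
  have [->|kj] := posnP (k j).
    by apply: sumr_ge0 => i ij; rewrite !mxE (negbTE ij) mulr_ge0.
  have [i ij ki] : exists2 i, i != j & k i <> 0%N.
    apply: contrapT => nok; apply: nopure; exists k; split=> // i ij.
    by apply: contrapT => ki; apply: nok; exists i.
  apply: (le_trans (kK k kh)); rewrite (bigD1 i) //= !mxE (negbTE ij).
  rewrite -[leLHS]addr0; apply: lerD.
    by rewrite -[leLHS]mulr1 ler_wpM2l // ler1n lt0n; apply/eqP.
  by apply: sumr_ge0 => l /andP[lj _]; rewrite !mxE (negbTE lj) mulr_ge0.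
rewrite mxE eqxx mulrN1 oppr_ge0 => t_le0.
by move: t0; rewrite eq_le t_le0 t_ge0.
Qed.

(** * Limits along an ultrafilter *)

Lemma near_ex2 (T : Type) (U : set_system T) (P Q : T -> Prop) :
  ProperFilter U -> (\forall t \near U, P t) -> (\forall t \near U, Q t) ->
  exists t, P t /\ Q t.
Proof. by move=> PU UP UQ; have [t] := filter_ex (filterI UP UQ); exists t. Qed.

Lemma near_seq (T : Type) (U : set_system T) (K : eqType) (s : seq K)
    (P : K -> T -> Prop) : Filter U ->
  (forall k, k \in s -> \forall t \near U, P k t) ->
  \forall t \near U, forall k, k \in s -> P k t.
Proof.
move=> FU; elim: s => [|k s ih] sP; first exact: filterE.
have /ih : forall l, l \in s -> \forall t \near U, P l t.
  by move=> l ls; apply: sP; rewrite inE ls orbT.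
have := sP k (mem_head _ _); apply: filterS2 => t Pk Ps l.
by rewrite inE => /predU1P[->//|/Ps].
Qed.

Definition eventually_bounded (R : realType) (T : Type) (U : set_system T)
    (a : T -> R) : Prop :=
  exists B, \forall t \near U, `|a t| <= B.

Lemma eventually_boundedM (R : realType) (T : Type) (U : set_system T)
    (a b : T -> R) : Filter U -> eventually_bounded U a ->
  eventually_bounded U b -> eventually_bounded U (fun t => a t * b t).
Proof.
move=> FU [A aA] [B bB]; exists (A * B); near=> t.
rewrite normrM; apply: ler_pM => //; [near: t; exact: aA|near: t; exact: bB].
Unshelve. all: by end_near. Qed.

Lemma eventually_bounded_cst (R : realType) (T : Type) (U : set_system T) (c : R) :
  Filter U -> eventually_bounded U (fun=> c).
Proof. by move=> FU; exists `|c|; exact: filterE. Qed.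

Lemma eventually_bounded_sum (R : realType) (T : Type) (U : set_system T)
    (I : Type) (r : seq I) (P : pred I) (a : I -> T -> R) : Filter U ->
  (forall i, P i -> eventually_bounded U (a i)) ->
  eventually_bounded U (fun t => \sum_(i <- r | P i) a i t).
Proof.
move=> FU aP; elim: r => [|i r [B ih]].
  by exists 0; apply: filterE => t; rewrite big_nil normr0.
case Pi : (P i); last first.
  by exists B; apply: filterS ih => t; rewrite big_cons Pi.
have [A aA] := aP i Pi; exists (A + B).
by apply: filterS2 aA ih => t ai ar; rewrite big_cons Pi (le_trans (ler_normD _ _)) // lerD.
Qed.

(** Ultrafilters replace the extraction of subsequences: bounded functions
    converge, and of two complementary cases exactly one holds eventually. *)
Lemma ultra_cvg_bounded (R : realType) (T : Type) (U : set_system T)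
    (a : T -> R) : UltraFilter U -> eventually_bounded U a ->
  exists l : R, a t @[t --> U] --> l.
Proof.
move=> UU [B aB].
have [l [_ lcl]] : `[- B, B]%classic `&` cluster (a @ U) !=set0.
  apply: (@segment_compact R (- B) B).
  by apply: filterS aB => t; rewrite /= in_itv /= ler_norml.
exists l => V Vl; have [//|nV] := in_ultra_setVsetC (a @^-1` V) UU.
have [z [/= nVz Vz]] := lcl (~` V) V nV Vl.
by have := nVz Vz.
Qed.

Lemma ultra_bounded_or_large (R : realType) (T : Type) (U : set_system T)
    (a : T -> R) : UltraFilter U ->
  eventually_bounded U a \/ forall B, \forall t \near U, B < `|a t|.
Proof.
move=> UU; have [|nb] := pselect (eventually_bounded U a); first by left.
right=> B; have [aB|] := in_ultra_setVsetC [set t | `|a t| <= B] UU.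
  by exfalso; apply: nb; exists B.
by apply: filterS => t /= /negP; rewrite -ltNge.
Qed.

(** Of two functions one is eventually at most the other, so that the maximum
    of finitely many is eventually realized by a fixed one. *)
Lemma ultra_argmax (R : realType) (T : Type) (U : set_system T) (K : eqType)
    (s : seq K) (phi : K -> T -> R) (k0 : K) : UltraFilter U -> k0 \in s ->
  exists2 k, k \in s & forall l, l \in s -> \forall t \near U, phi l t <= phi k t.
Proof.
move=> UU; elim: s k0 => // k s ih k0 _.
case: s ih => [|l0 s] ih.
  exists k; first exact: mem_head.
  by move=> l; rewrite inE => /eqP ->; apply: filterE.
have [l ls lmax] := ih l0 (mem_head _ _).
have [kl|lk] := in_ultra_setVsetC [set t | phi k t <= phi l t] UU.
  exists l; first by rewrite inE ls orbT.
  by move=> j; rewrite inE => /predU1P[->//|]; exact: lmax.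
exists k; first exact: mem_head.
move=> j; rewrite inE => /predU1P[->|/lmax]; first exact: filterE.
by apply: filterS2 lk => t /= /negP; rewrite -ltNge => /ltW kl /le_trans; apply.
Qed.

(** The values [inner (v t) a] are bounded, but [v t] may be unbounded.  Applying the
    partial inverse of [v |-> (inner v a)_a], a fixed linear map, to these values
    gives a bounded vector [w t] with the same values. *)
Lemma bounded_part (R : realType) (T : Type) (U : set_system T) (n : nat)
    (v : T -> 'rV[R]_n) (s : seq 'rV[R]_n) : Filter U ->
  (forall a, a \in s -> eventually_bounded U (fun t => inner (v t) a)) ->
  exists w : T -> 'rV[R]_n,
    (forall j, eventually_bounded U (fun t => w t ord0 j)) /\
    forall t a, a \in s -> inner (v t - w t) a = 0.
Proof.
move=> FU sb.
pose A : 'M[R]_(size s, n) := \matrix_i s`_i.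
pose w t := v t *m A^T *m pinvmx A^T.
have vA t i : (v t *m A^T) ord0 i = inner (v t) s`_i.
  by rewrite mxE; apply: eq_bigr => j _; rewrite !mxE.
exists w; split=> [j|t a /(nthP 0)[i si <-]].
  rewrite (_ : (fun t => w t ord0 j) =
      fun t => \sum_(i < size s) inner (v t) s`_i * pinvmx A^T i j); last first.
    by apply/funext => t; rewrite mxE; apply: eq_bigr => i _; rewrite vA.
  apply: eventually_bounded_sum => i _; apply: eventually_boundedM.
    by apply: sb; exact: mem_nth.
  exact: eventually_bounded_cst.
have : (v t - w t) *m A^T = 0.
  by rewrite mulmxBl /w mulmxKpV ?submxMl // subrr.
move=> /(congr1 (fun M : 'rV[R]__ => M ord0 (Ordinal si))); rewrite !mxE => <-.
by apply: eq_bigr => j _; rewrite !mxE.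
Qed.

(** * Asymptotics of monomials along a path to infinity *)

Lemma innerBl (R : realType) (n : nat) (x y q : 'rV[R]_n) :
  inner (x - y) q = inner x q - inner y q.
Proof.
by rewrite /inner -sumrB; apply: eq_bigr => i _; rewrite !mxE mulrBl.
Qed.

Lemma innerBr (R : realType) (n : nat) (q x y : 'rV[R]_n) :
  inner q (x - y) = inner q x - inner q y.
Proof.
by rewrite /inner -sumrB; apply: eq_bigr => i _; rewrite !mxE mulrBr.
Qed.

Lemma eventually_bounded_inner (R : realType) (T : Type) (U : set_system T)
    (n : nat) (w : T -> 'rV[R]_n) (a : 'rV[R]_n) : Filter U ->
  (forall j, eventually_bounded U (fun t => w t ord0 j)) ->
  eventually_bounded U (fun t => inner (w t) a).
Proof.
move=> FU wb; apply: eventually_bounded_sum => j _.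
by apply: eventually_boundedM => //; exact: eventually_bounded_cst.
Qed.

Lemma cvg_expR_Nlarge (R : realType) (T : Type) (U : set_system T)
    (a : T -> R) : Filter U -> (forall B, \forall t \near U, a t < B) ->
  expR (a t) @[t --> U] --> (0 : R).
Proof.
move=> FU aB; apply/cvgr0Pnorm_lt => e e0.
near=> t; rewrite ger0_norm ?expR_ge0 // -[ltRHS]lnK ?posrE // ltr_expR.
by near: t; exact: aB.
Unshelve. all: by end_near. Qed.

(** A monomial that involves a variable outside of [J] vanishes where the
    coordinates outside of [J] do. *)
Definition supported_in (n : nat) (J : pred 'I_n) (k : multinom n) : bool :=
  [forall j, J j || (k j == 0%N)].

Lemma monomial_polar (R : realType) (n : nat) (J : pred 'I_n)
    (sg v x : 'rV[R]_n) (k : multinom n) : supported_in J k ->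
  (forall j, J j -> x ord0 j = sg ord0 j * expR (v ord0 j)) ->
  monomial x k = monomial sg k * expR (inner v (exponent R k)).
Proof.
move=> /forallP kJ xE; rewrite expR_sum -big_split; apply: eq_bigr => j _ /=.
rewrite mxE; have /orP[Jj|/eqP ->] := kJ j.
  by rewrite xE // exprMn [v ord0 j * _]mulrC expRM_natl.
by rewrite !expr0 mulr0 expR0 mulr1.
Qed.

Lemma monomial_eq0 (R : realType) (n : nat) (J : pred 'I_n) (x : 'rV[R]_n)
    (k : multinom n) : ~~ supported_in J k ->
  (forall j, ~~ J j -> x ord0 j = 0) -> monomial x k = 0.
Proof.
move=> /forallPn[j]; rewrite negb_or => /andP[Jj kj] xE.
by rewrite /monomial (bigD1 j) //= xE // expr0n (negbTE kj) mul0r.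
Qed.

Lemma cvg_bigsum (R : realType) (T : Type) (U : set_system T) (I : Type)
    (r : seq I) (P : pred I) (f : I -> T -> R) (l : I -> R) : Filter U ->
  (forall i, P i -> f i t @[t --> U] --> l i) ->
  \sum_(i <- r | P i) f i t @[t --> U] --> \sum_(i <- r | P i) l i.
Proof.
move=> FU fl; elim: r => [|i r ih].
  by under eq_fun do rewrite big_nil; rewrite big_nil; exact: cvg_cst.
under eq_fun do rewrite big_cons; rewrite big_cons; case: ifP => // Pi.
exact: (cvgD (fl i Pi) ih).
Qed.

(** Each coordinate is eventually zero, eventually positive or eventually
    negative; [J] is the set of those that are eventually nonzero. *)
Lemma ultra_polar (R : realType) (T : Type) (U : set_system T) (n : nat)
    (x : T -> 'rV[R]_n) : UltraFilter U ->
  exists (J : pred 'I_n) (sg : 'rV[R]_n),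
    (forall j, sg ord0 j != 0) /\ \forall t \near U, forall j,
      x t ord0 j = if J j then sg ord0 j * expR (ln `|x t ord0 j|) else 0.
Proof.
move=> UU.
have /fin_all_exists2[c c0 cE] (j : 'I_n) : exists2 c : bool * R, c.2 != 0 &
    \forall t \near U, x t ord0 j = if c.1 then c.2 * expR (ln `|x t ord0 j|) else 0.
  have [xj0|] := in_ultra_setVsetC [set t | x t ord0 j = 0] UU.
    by exists (false, 1) => //=; exact: oner_neq0.
  have [xjp|xjn] := in_ultra_setVsetC [set t | 0 < x t ord0 j] UU => xj0.
    exists (true, 1); first exact: oner_neq0.
    by apply: filterS xjp => t /= x0; rewrite gtr0_norm // lnK ?posrE // mul1r.
  exists (true, -1); first by rewrite oppr_eq0 oner_neq0.
  apply: filterS2 xj0 xjn => t /= /eqP x0 /negP; rewrite -leNgt => x_le0.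
  by rewrite lnK ?posrE ?normr_gt0 // ler0_norm // mulN1r opprK.
exists (fun j => (c j).1), (\row_j (c j).2); split=> [j|]; first by rewrite mxE.
apply: filterS (filter_forall _ cE) => t ct j.
by rewrite mxE; exact: ct.
Qed.

(** Along a path to infinity, the dominant monomials of each [F i] are those of
    a face of its Newton polyhedron, for one covector [q] common to all [i], and
    after division by [M i] they converge to their values at a point [y] of
    the torus.  In the proof, [v] is the vector of logarithms, [phi k] the
    logarithm of the monomial [k], [w] the bounded part of [v] and [u = v - w].
    Convenience provides a pure power of a coordinate that tends to infinity,
    which makes [M i] tend to infinity and [face_val] negative. *)
Lemma tropical_limit (R : realType) (T : Type) (U : set_system T) (n p : nat)
    (F : 'I_p -> mpoly n R) (x : T -> 'rV[R]_n) :
  UltraFilter U -> convenient F ->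
  (forall B, \forall t \near U, B < sqnorm (x t)) ->
  exists (q y : 'rV[R]_n) (M : 'I_p -> T -> R),
  [/\ forall j, y ord0 j != 0,
      forall i, face_val q (newton (F i)) < 0,
      forall i B, \forall t \near U, B < M i t
    & forall i k, k \in msupp (F i) ->
      monomial (x t) k / M i t @[t --> U] -->
      (if exponent R k \in face q (newton (F i)) then monomial y k else 0)].
Proof.
move=> UU Fconv xlarge.
have [J [sg [sg0 polar]]] := ultra_polar x UU.
pose v t : 'rV[R]_n := \row_j ln `|x t ord0 j|.
have xE : \forall t \near U, forall k, monomial (x t) k = if supported_in J k
    then monomial sg k * expR (inner (v t) (exponent R k)) else 0.
  apply: filterS polar => t xt k; case: ifPn => kJ.
    by apply: (monomial_polar kJ) => j Jj; rewrite [LHS]xt Jj mxE.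
  by apply: (monomial_eq0 kJ) => j /negbTE Jj; rewrite xt Jj.
have [j0 xj0] : exists j0, forall B : R, \forall t \near U, B < `|x t ord0 j0|.
  apply: contrapT => noj.
  have [B sB] : eventually_bounded U (fun t => sqnorm (x t)).
    apply: eventually_bounded_sum => j _.
    have [xb|xl] := @ultra_bounded_or_large R T U (fun t => x t ord0 j) UU.
      exact: eventually_boundedM.
    by exfalso; apply: noj; exists j.
  have [t [h1 h2]] := near_ex2 _ (xlarge B) sB.
  by move: h1; rewrite ltNge (le_trans (ler_norm _) h2).
have Jj0 : J j0.
  apply: contrapT => /negP nJ.
  have [t [/(_ j0)]] := near_ex2 _ polar (xj0 0).
  by rewrite (negbTE nJ) => ->; rewrite normr0 ltxx.
(* The monomials in [S i] are those that do not vanish along the path. *)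
pose phi (k : multinom n) t := inner (v t) (exponent R k).
pose S i := [seq k <- msupp (F i) | supported_in J k].
have pure i : exists2 k, k \in S i & forall B : R, \forall t \near U, B < phi k t.
  have [k [ki kj0 k0]] := convenient_pure_power (Fconv i) j0.
  exists k.
    rewrite mem_filter ki andbT; apply/forallP => j.
    by have [->|/k0 ->] := eqVneq j j0; rewrite ?Jj0 // eqxx orbT.
  move=> B; near=> t.
  have vB : Num.max B 0 < v t ord0 j0.
    rewrite mxE -ltr_expR lnK ?posrE; last first.
      by apply: le_lt_trans (_ : 0 < _) => //; near: t; exact: xj0.
    by near: t; exact: xj0.
  rewrite /phi /inner (bigD1 j0) //= big1 => [|j /k0]; last first.
    by rewrite !mxE => ->; rewrite mulr0.
  rewrite addr0 [exponent R k _ _]mxE; move: vB; rewrite gt_max => /andP[vB v0].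
  by rewrite (lt_le_trans vB) // ler_peMr ?ler1n // ltW.
have /fin_all_exists2[kmax kmaxS kmaxP] (i : 'I_p) : exists2 k, k \in S i &
    forall l, l \in S i -> \forall t \near U, phi l t <= phi k t.
  by have [k0 k0S _] := pure i; exact: ultra_argmax k0S.
have kmax_large i B : \forall t \near U, B < phi (kmax i) t.
  have [k kS /(_ B)] := pure i; apply: filterS2 (kmaxP i k kS) => t.
  by move=> le1 /lt_le_trans; apply.
(* The dominant monomials: those comparable with the largest one. *)
pose dom i k := `[< eventually_bounded U (fun t => phi (kmax i) t - phi k t) >].
have ndom i k : k \in S i -> ~~ dom i k ->
    forall B, \forall t \near U, B < phi (kmax i) t - phi k t.
  move=> kS /asboolPn nb B.
  have [//|/(_ B)] := @ultra_bounded_or_large R T U (fun t => phi (kmax i) t - phi k t) UU.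
  apply: filterS2 (kmaxP i k kS) => t le1.
  by rewrite ger0_norm // subr_ge0.
pose s := flatten [seq [seq exponent R (kmax i) - exponent R k | k <- S i & dom i k]
  | i <- enum 'I_p].
have [|w [wb wE]] := @bounded_part R T U n v s _ _.
  move=> a /flatten_mapP[i _ /mapP[k]]; rewrite mem_filter => /andP[/asboolP ikb _] ->.
  by under eq_fun do rewrite innerBr.
have phiE i k : k \in S i -> dom i k -> forall t,
    inner (v t - w t) (exponent R (kmax i)) = inner (v t - w t) (exponent R k).
  move=> kS ik t; apply/eqP; rewrite -subr_eq0 -innerBr; apply/eqP/wE.
  apply/flatten_mapP; exists i; first by rewrite mem_enum.
  by apply/mapP; exists k => //; rewrite mem_filter ik.
have /fin_all_exists[W wW] (j : 'I_n) : exists l : R, w t ord0 j @[t --> U] --> l.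
  exact: ultra_cvg_bounded.
pose u t := v t - w t.
have large_sub a (b : T -> R) : eventually_bounded U b ->
    (forall B, \forall t \near U, B < a t) ->
    forall B : R, \forall t \near U, B < a t - b t.
  move=> [C bC] aB B; near=> t.
  rewrite ltrBrDr (@le_lt_trans _ _ (B + C)) //; last by near: t; exact: aB.
  by rewrite lerD2l (le_trans (ler_norm _)) //; near: t.
have wbi a : eventually_bounded U (fun t => inner (w t) a).
  exact: eventually_bounded_inner.
have u_large i B : \forall t \near U, B < inner (u t) (exponent R (kmax i)).
  have := large_sub _ _ (wbi (exponent R (kmax i))) (kmax_large i) B.
  by apply: filterS => t; rewrite innerBl.
have u_gap i k : k \in S i -> ~~ dom i k -> forall B, \forall t \near U,
    B < inner (u t) (exponent R (kmax i)) - inner (u t) (exponent R k).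
  move=> kS ik B.
  have := large_sub _ _ (wbi (exponent R (kmax i) - exponent R k)) (ndom i k kS ik) B.
  by apply: filterS => t; rewrite innerBr /u !innerBl /phi; lra.
(* A single far enough point of the path provides the covector. *)
have [t0 [u0 gap0]] : exists t,
    (forall i, 0 < inner (u t) (exponent R (kmax i))) /\
    (forall i k, k \in S i -> ~~ dom i k ->
      inner (u t) (exponent R k) < inner (u t) (exponent R (kmax i))).
  apply: (@near_ex2 T U).
    by apply: filter_forall => i; exact: u_large.
  apply: filter_forall => i; apply: near_seq => k kS.
  have [ik|ik] := boolP (dom i k); first exact: filterE.
  by apply: filterS (u_gap i k kS ik 0) => t; rewrite subr_gt0.
(* On the coordinates that vanish along the path, [q] is so large that no
   monomial involving one of them can be minimal. *)
pose Tb : R := \sum_(i < p) \sum_(k <- msupp (F i))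
  \sum_j `|u t0 ord0 j| * (k j)%:R.
have abs_ge0 (k : multinom n) : 0 <= \sum_j `|u t0 ord0 j| * (k j)%:R.
  by apply: sumr_ge0 => j _; rewrite mulr_ge0.
have TbP i k : k \in msupp (F i) -> \sum_j `|u t0 ord0 j| * (k j)%:R <= Tb.
  move=> ki; rewrite /Tb (bigD1 i) //= (big_rem k) //= -addrA lerDl.
  by rewrite addr_ge0 // sumr_ge0 // => l _; rewrite ?sumr_ge0.
have Tb0 : 0 <= Tb by do 2![apply: sumr_ge0 => ? _].
pose q : 'rV[R]_n := \row_j if J j then - u t0 ord0 j else Tb.
have qS i k : k \in S i -> inner q (exponent R k) = - inner (u t0) (exponent R k).
  rewrite mem_filter => /andP[/forallP kJ _].
  rewrite -sumrN; apply: eq_bigr => j _; rewrite !mxE.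
  by have := kJ j; case: ifP => /= [_ _|_ /eqP ->]; rewrite ?mulNr // !mulr0 oppr0.
have qnS i k : k \in msupp (F i) -> k \notin S i -> 0 <= inner q (exponent R k).
  move=> ki; rewrite mem_filter ki andbT => /forallPn[j1].
  rewrite negb_or => /andP[Jj1 kj1].
  rewrite -(lerD2r (\sum_j `|u t0 ord0 j| * (k j)%:R)) add0r.
  apply: (le_trans (TbP i k ki)); rewrite -big_split (bigD1 j1) //= !mxE (negbTE Jj1).
  rewrite -[leLHS]addr0; apply: lerD.
    by apply: ler_wpDr => //; rewrite ler_peMr // ler1n lt0n.
  apply: sumr_ge0 => j _; rewrite [q _ _]mxE [exponent R k _ _]mxE -mulrDl mulr_ge0 //.
  case: ifP => _; last by rewrite addr_ge0.
  by rewrite addrC subr_ge0 ler_norm.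
have kmaxF i : kmax i \in msupp (F i).
  by have := kmaxS i; rewrite mem_filter => /andP[].
have faceE i : face_val q (newton (F i)) = inner q (exponent R (kmax i)).
  apply: face_val_newton => // k ki; rewrite (qS i) //.
  have [kS|/(qnS i k ki)] := boolP (k \in S i); last first.
    by apply: le_trans; rewrite oppr_le0 ltW.
  rewrite (qS i) // lerN2; have [ik|ik] := boolP (dom i k).
    by rewrite /u (phiE i k).
  by rewrite ltW // gap0.
have in_face i k : k \in msupp (F i) ->
    (exponent R k \in face q (newton (F i))) = (k \in S i) && dom i k.
  move=> ki; apply/idP/andP; rewrite inE /face /= faceE (qS i (kmax i)) //.
    move=> [_ qk]; have kS : k \in S i.
      apply: contrapT => /negP /(qnS i k ki); rewrite qk oppr_ge0.
      by rewrite leNgt u0.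
    split=> //; apply: contrapT => /negP /(gap0 i k kS).
    by move: qk; rewrite (qS i) // => /oppr_inj ->; rewrite ltxx.
  move=> [kS ik]; split; first exact: newton_exponent.
  by rewrite (qS i) // /u (phiE i k).
pose y : 'rV[R]_n := \row_j if J j then sg ord0 j * expR (W j) else 1.
exists q, y, (fun i t => expR (inner (u t) (exponent R (kmax i)))); split.
- move=> j; rewrite mxE; case: ifP => _; last exact: oner_neq0.
  by rewrite mulf_neq0 // gt_eqF // expR_gt0.
- by move=> i; rewrite faceE (qS i) // oppr_lt0.
- move=> i B; apply: filterS (u_large i B) => t /lt_le_trans; apply.
  by apply: le_trans (expR_ge1Dx _); rewrite lerDr.
move=> i k ki; rewrite in_face //.
have [kS|kS] := boolP (k \in S i); last first.
  rewrite /=; apply: cvg_near_cst; apply: filterS xE => t ->.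
  by move: kS; rewrite mem_filter ki andbT => /negbTE ->; rewrite mul0r.
have kJ : supported_in J k by move: kS; rewrite mem_filter => /andP[].
have ratioE : \forall t \near U, monomial sg k *
    expR (inner (w t) (exponent R k) +
      (inner (u t) (exponent R k) - inner (u t) (exponent R (kmax i)))) =
    monomial (x t) k / expR (inner (u t) (exponent R (kmax i))).
  apply: filterS xE => t ->; rewrite kJ -expRN -mulrA -expRD; congr (_ * expR _).
  by rewrite /u !innerBl; lra.
apply: cvg_trans; first exact: near_eq_cvg ratioE.
have [ik|ik] := boolP (dom i k) => /=.
  rewrite (monomial_polar (x := y) (sg := sg) (v := \row_j W j) kJ); last first.
    by move=> j Jj; rewrite !mxE Jj.
  apply: cvgM; first exact: cvg_cst.
  under eq_fun do rewrite /u (phiE i k) // subrr addr0.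
  apply: continuous_cvg; first exact: continuous_expR.
  apply: cvg_bigsum => j _; rewrite [(\row__ _) _ _]mxE.
  by apply: cvgM; [exact: wW|exact: cvg_cst].
rewrite -(mulr0 (monomial sg k)).
apply: cvgM; first exact: cvg_cst.
apply: cvg_expR_Nlarge => B; have [C wC] := wbi (exponent R k).
apply: filterS2 wC (u_gap i k kS ik (C - B)) => t wC uB.
have := le_trans (ler_norm _) wC; lra.
Unshelve. all: by end_near. Qed.

(** * Nondegeneracy at infinity and solvability *)

Lemma cvg_eq (R : realType) (T : Type) (U : set_system T) (a : T -> R)
    (l l' : R) : ProperFilter U ->
  a t @[t --> U] --> l -> a t @[t --> U] --> l' -> l = l'.
Proof. by move=> PU al al'; apply: cvg_unique al al'; exact: norm_hausdorff. Qed.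

Lemma cvg0_div_large (R : realType) (T : Type) (U : set_system T)
    (a b : T -> R) : Filter U -> eventually_bounded U a ->
  (forall B, \forall t \near U, B < b t) -> a t / b t @[t --> U] --> (0 : R).
Proof.
move=> FU [C aC] bl; apply/cvgr0Pnorm_lt => e e0; near=> t.
have b0 : 0 < b t by near: t; exact: bl.
rewrite normrM normfV (gtr0_norm b0) ltr_pdivrMr // mulrC -ltr_pdivrMr //.
apply: (@le_lt_trans _ _ (C / e)); last by near: t; exact: bl.
by rewrite ler_pM2r ?invr_gt0 //; near: t.
Unshelve. all: by end_near. Qed.

Lemma enum_val_ord_homo (p : nat) (A : {set 'I_p}) :
  {homo (fun l : 'I_#|A| => enum_val l) : i j / (i < j)%N}.
Proof.
move=> i j ij.
have sorted_enum : sorted (relpre (@nat_of_ord p) ltn) (enum A).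
  rewrite {1}/enum_mem; apply: sorted_filter.
    by move=> a b c /=; exact: ltn_trans.
  by rewrite -enumT -sorted_map val_enum_ord iota_ltn_sorted.
have tr : transitive (relpre (@nat_of_ord p) ltn) by move=> a b c; exact: ltn_trans.
rewrite /enum_val (set_nth_default (enum_default j)) -?cardE //.
by apply: (sorted_ltn_nth tr) => //; rewrite inE -cardE.
Qed.

(** The weights [mu i], which are [lambda i * M i] normalized to have sum [1],
    converge; those with a nonzero limit form the subfamily to which
    nondegeneracy is applied.  The normalizing factor [N] tends to infinity, since
    the sum of the [lambda i] is at least [1], so that everything bounded
    disappears in the limit. *)
Lemma no_critical_sequence (R : realType) (T : Type) (U : set_system T)
    (n p : nat) (F : 'I_p -> mpoly n R) (x : T -> 'rV[R]_n)
    (lambda : T -> 'I_p -> R) (C : 'I_p -> R) :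
  UltraFilter U -> convenient F -> nondegenerate_at_infinity F ->
  (forall B, \forall t \near U, B < sqnorm (x t)) ->
  (forall t i, 0 <= lambda t i) -> (forall t, \sum_i lambda t i ^+ 2 = 1) ->
  (forall t i, 0 < lambda t i -> `|pfun (F i) (x t)| <= C i) ->
  ~ forall t j,
    `|\sum_i lambda t i * (x t ord0 j * pfun (mderiv j (F i)) (x t))| <= 1.
Proof.
move=> UU Fconv Fnd xlarge lambda_ge0 lambda1 FC grad_le1.
have [q [y [M [y0 qneg Mlarge Mcvg]]]] := tropical_limit UU Fconv xlarge.
pose FD i := restr (F i) (face q (newton (F i))).
have sum_cvg (a : multinom n -> R) i :
    (\sum_(k <- msupp (F i)) a k * monomial (x t) k) / M i t @[t --> U] -->
    \sum_(k <- msupp (F i) | exponent R k \in face q (newton (F i)))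
      a k * monomial y k.
  rewrite big_mkcond big_seq.
  under eq_fun do rewrite mulr_suml big_seq.
  apply: cvg_bigsum => k ki; under eq_fun do rewrite -mulrA.
  rewrite (_ : (if _ then _ else _) = a k *
    (if exponent R k \in face q (newton (F i)) then monomial y k else 0)); last first.
    by case: ifP => _; rewrite ?mulr0.
  by apply: cvgM; [exact: cvg_cst|exact: Mcvg].
have val_cvg i : pfun (F i) (x t) / M i t @[t --> U] --> pfun (FD i) y.
  rewrite /FD /restr pfun_sum; under eq_fun do rewrite pfunE.
  exact: sum_cvg.
have grad_cvg i j : x t ord0 j * pfun (mderiv j (F i)) (x t) / M i t @[t --> U] -->
    y ord0 j * pfun (mderiv j (FD i)) y.
  rewrite /FD /restr mul_pfun_mderiv_sum; under eq_fun do rewrite mul_pfun_mderiv.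
  exact: (sum_cvg (fun k => mcoeff k (F i) * (k j)%:R)).
pose N t := \sum_i lambda t i * M i t.
have lambda_sum t : 1 <= \sum_i lambda t i.
  rewrite -(lambda1 t); apply: ler_sum => i _; rewrite expr2.
  rewrite ler_piMr // -(@ler_sqr _ _ 1) ?nnegrE // expr1n -(lambda1 t).
  by rewrite (bigD1 i) //= lerDl sumr_ge0 // => l _; exact: sqr_ge0.
have N_large B : \forall t \near U, B < N t.
  have : \forall t \near U, forall i, `|B| + 1 < M i t.
    by apply: filter_forall => i; exact: Mlarge.
  apply: filterS => t tM.
  apply: (@lt_le_trans _ _ (`|B| + 1)).
    by rewrite (le_lt_trans (ler_norm _)) // ltrDl.
  apply: (@le_trans _ _ (\sum_i lambda t i * (`|B| + 1))).
    by rewrite -mulr_suml ler_peMl // addr_ge0.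
  by apply: ler_sum => i _; apply: ler_wpM2l => //; exact: ltW.
have M_gt0 : \forall t \near U, forall i, 0 < M i t.
  by apply: filter_forall => i; exact: Mlarge.
pose mu i t := lambda t i * M i t / N t.
have /fin_all_exists[m mcvg] i : exists l : R, mu i t @[t --> U] --> l.
  apply: ultra_cvg_bounded; exists 1; near=> t.
  have N0 : 0 < N t by near: t; exact: N_large.
  have M0 : forall l, 0 < M l t by near: t.
  have lM0 l : 0 <= lambda t l * M l t by rewrite mulr_ge0 // ltW.
  rewrite ger0_norm; last by rewrite divr_ge0 // ltW.
  rewrite ler_pdivrMr // mul1r /N (bigD1 i) //= lerDl sumr_ge0 //.
have m_sum : \sum_i m i = 1.
  have mu1 : \sum_i mu i t @[t --> U] --> \sum_i m i by exact: cvg_bigsum.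
  apply: (@cvg_eq R T U (fun t => \sum_i mu i t)) => //.
  apply: cvg_near_cst; near=> t; rewrite -mulr_suml divff // gt_eqF //.
  by near: t; exact: N_large.
have FD0 i : m i != 0 -> pfun (FD i) y = 0.
  move=> mi0; have lambda_gt0 : \forall t \near U, 0 < lambda t i.
    have [//|lambda0] := in_ultra_setVsetC [set t | 0 < lambda t i] UU.
    case/eqP: mi0; apply: (@cvg_eq R T U (mu i)) => //.
    apply: cvg_near_cst; apply: filterS lambda0 => t /negP; rewrite -leNgt => l0.
    by rewrite /mu (_ : lambda t i = 0) ?mul0r //; apply/eqP; rewrite eq_le l0 /=.
  apply: (@cvg_eq R T U (fun t => pfun (F i) (x t) / M i t)) => //.
  apply: cvg0_div_large => //; exists (C i).
  by apply: filterS lambda_gt0 => t; exact: FC.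
have grad0 j : \sum_i m i * (y ord0 j * pfun (mderiv j (FD i)) y) = 0.
  pose G t := \sum_i mu i t * (x t ord0 j * pfun (mderiv j (F i)) (x t) / M i t).
  apply: (@cvg_eq R T U G) => //.
    by apply: cvg_bigsum => i _; apply: cvgM.
  pose H t := \sum_i lambda t i * (x t ord0 j * pfun (mderiv j (F i)) (x t)).
  have H0 : H t / N t @[t --> U] --> (0 : R).
    by apply: cvg0_div_large => //; exists 1; apply: filterE => t; exact: grad_le1.
  apply: cvg_trans H0; apply: near_eq_cvg; near=> t.
  have M0 : forall l, 0 < M l t by near: t.
  rewrite /H mulr_suml; apply: eq_bigr => i _; rewrite /mu.
  have N0 : N t != 0 by rewrite gt_eqF //; near: t; exact: N_large.
  have Mi0 : M i t != 0 by rewrite gt_eqF.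
  by field; rewrite Mi0 N0.
pose I : {set 'I_p} := [set i | m i != 0]%SET.
have I_gt0 : (0 < #|I|)%N.
  rewrite lt0n; apply/eqP => /card0_eq I0; move: m_sum; rewrite big1 => [/eqP|i _].
    by rewrite eq_sym oner_eq0.
  by apply/eqP; have := I0 i; rewrite !inE => /negbFE.
apply: (Fnd #|I| (fun l => enum_val l) I_gt0 (@enum_val_ord_homo p I) q).
  by move=> l; exact: qneg.
exists y, (fun l => m (enum_val l)); split => //.
- by move=> l; have := enum_valP l; rewrite inE.
- by move=> l; apply: FD0; have := enum_valP l; rewrite inE.
transitivity (\sum_(i in I) m i *: gradient (FD i) y).
  by rewrite [RHS]big_enum_val.
apply/rowP => j; rewrite summxE mxE; apply: (mulfI (y0 j)).
rewrite mulr0 mulr_sumr -[RHS](grad0 j) [RHS](bigID (fun i => i \in I)) /=.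
rewrite [X in _ = _ + X]big1 ?addr0 => [|i].
  by apply: eq_bigr => i _; rewrite !mxE mulrCA.
by rewrite inE negbK => /eqP ->; rewrite mul0r.
Unshelve. all: by end_near. Qed.

Lemma sublevel_attained (R : realType) (n p : nat) (F : 'I_p -> mpoly n R)
    (c : 'I_p -> R) : convenient F -> nondegenerate_at_infinity F ->
  (forall d, 0 < d -> exists x, forall i, pfun (F i) x <= c i + d) ->
  exists x, forall i, pfun (F i) x <= c i.
Proof.
move=> Fconv Fnd inf0; apply: contrapT => nosol.
have nosol' x : exists i, c i < pfun (F i) x.
  apply: contrapT => noi; apply: nosol; exists x => i; rewrite leNgt.
  by apply/negP => ci; apply: noi; exists i.
have /choice[x xP] k := critical_points_at_infinity inf0 nosol' (k%:R : R).
have {xP} /choice[lambda xP] := xP.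
have [U [UU ooU]] := @ultraFilterLemma nat \oo _.
apply: (@no_critical_sequence R nat U n p F x lambda (fun i => `|c i| + 1)) => //.
- move=> B; apply: ooU.
  near=> k; have [xk _ _ _ _] := xP k.
  apply: lt_trans xk; near: k; exact: nbhs_infty_gtr.
- by move=> k; have [] := xP k.
- by move=> k; have [] := xP k.
- by move=> k; have [] := xP k.
- by move=> k; have [] := xP k.
Unshelve. all: by end_near. Qed.

(** * Semialgebraic sets of the plane *)

Module QE := ordered_qelim.ord.

(** The variables of the polynomial are numbered from [o] on, which leaves the
    first [o] numbers to the parameters. *)
Lemma term_of_mpoly (R : realType) (n : nat) (p : mpoly n R) (o : nat) :
  exists2 T : GRing.term R, GRing.rterm T &
    forall e : seq R, GRing.eval e T = meval (fun i : 'I_n => e`_(o + i)) p.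
Proof.
pose mon (k : multinom n) : GRing.term R :=
  \big[@GRing.Mul R/GRing.NatConst R 1]_(i < n) GRing.Exp (GRing.Var R (o + i)) (k i).
exists (\big[@GRing.Add R/GRing.NatConst R 0]_(k <- msupp p)
  GRing.Mul (GRing.Const (mcoeff k p)) (mon k)).
  apply: (big_ind (fun T => GRing.rterm T)) => //= [T1 T2 -> -> //|k _].
  by apply: (big_ind (fun T => GRing.rterm T)) => //= T1 T2 -> ->.
move=> e; rewrite mevalE (big_morph (GRing.eval e) (id1 := 0) (op1 := +%R)) //.
apply: eq_bigr => k _ /=; congr (_ * _).
by rewrite (big_morph (GRing.eval e) (id1 := 1) (op1 := *%R)).
Qed.

Lemma holds_exists_block (R : realType) (F : QE.formula R) (o n : nat)
    (e : seq R) :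
  QE.holds e (foldr (@QE.Exists R) F (iota o n)) <->
  exists2 e' : seq R,
    (forall i, ~~ (o <= i < o + n)%N -> e'`_i = e`_i) & QE.holds e' F.
Proof.
elim: n o e => [|n ih] o e /=.
  split=> [eF|[e' ee' e'F]]; first by exists e.
  apply: QE.eq_holds e'F => i; apply: ee'.
  by rewrite addn0; apply/negP => /andP[/leq_ltn_trans h /h]; rewrite ltnn.
split=> [[x /ih[e' ee' e'F]]|[e' ee' e'F]].
  exists e' => // i io; rewrite ee'; last first.
    by apply: contra io => /andP[/ltnW -> /=]; rewrite addSnnS.
  rewrite nth_set_nth /=; case: eqP => // ioE; move: io.
  by rewrite ioE leqnn addnS ltnS leq_addr.
exists e'`_o; apply/ih; exists e' => // i io.
rewrite nth_set_nth /=; case: eqP => [->//|/eqP ioE]; apply: ee'.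
apply: contra io => /andP[oi ?]; rewrite addSnnS; apply/andP; split => //.
by rewrite ltn_neqAle oi andbT eq_sym.
Qed.

(** The variable [t], number [0], is the outer one: a polynomial in [t] whose
    coefficients are polynomials in [s] can be divided by a power of [t]. *)
Lemma bipoly_of_term (R : realType) (T : GRing.term R) : GRing.rterm T ->
  exists P : {poly {poly R}},
    forall t s, GRing.eval [:: t; s] T = P.[t%:P].[s].
Proof.
elim: T => //=.
- case=> [|[|i]] _; [exists 'X|exists 'X%:P|exists 0] => t s /=.
  + by rewrite hornerX hornerC.
  + by rewrite hornerC hornerX.
  + by rewrite nth_nil !horner0.
- by move=> c _; exists c%:P%:P => t s; rewrite !hornerC.
- by move=> k _; exists k%:R => t s; rewrite -!polyC_natr !hornerC.
- move=> T1 ih1 T2 ih2 /andP[/ih1[P1 P1E] /ih2[P2 P2E]].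
  by exists (P1 + P2) => t s; rewrite !hornerD P1E P2E.
- by move=> T1 ih1 /ih1[P1 P1E]; exists (- P1) => t s; rewrite !hornerN P1E.
- by move=> T1 ih1 k /ih1[P1 P1E]; exists (P1 *+ k) => t s; rewrite !hornerMn P1E.
- move=> T1 ih1 T2 ih2 /andP[/ih1[P1 P1E] /ih2[P2 P2E]].
  by exists (P1 * P2) => t s; rewrite !hornerM P1E P2E.
- move=> T1 ih1 k /ih1[P1 P1E].
  by exists (P1 ^+ k) => t s; rewrite !horner_exp P1E.
Qed.

(** Only the implication is asked for: exchanging [s] and [s'] gives the
    converse. *)
Definition sign_determined (R : realType) (A : R -> R -> Prop)
    (Ps : seq {poly {poly R}}) : Prop :=
  forall t s s', (forall P, P \in Ps ->
    Num.sg P.[t%:P].[s] = Num.sg P.[t%:P].[s']) -> A t s -> A t s'.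

Lemma sign_determined_qf (R : realType) (F : QE.formula R) :
  QE.qf_form F -> QE.rformula F ->
  exists Ps : seq {poly {poly R}}, forall t s s', (forall P, P \in Ps ->
    Num.sg P.[t%:P].[s] = Num.sg P.[t%:P].[s']) ->
    QE.qf_eval [:: t; s] F = QE.qf_eval [:: t; s'] F.
Proof.
elim: F => //=.
- by move=> b _ _; exists [::].
- move=> T1 T2 _ /andP[/bipoly_of_term[P1 P1E] /bipoly_of_term[P2 P2E]].
  exists [:: P1 - P2] => t s s' /(_ _ (mem_head _ _)).
  rewrite !hornerD !hornerN !P1E !P2E -!(subr_eq0 P1.[_].[_]) => sg12.
  by rewrite -sgr_eq0 sg12 sgr_eq0.
- move=> T1 T2 _ /andP[/bipoly_of_term[P1 P1E] /bipoly_of_term[P2 P2E]].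
  exists [:: P1 - P2] => t s s' /(_ _ (mem_head _ _)).
  rewrite !hornerD !hornerN !P1E !P2E -!(subr_lt0 _ P1.[_].[_]) => sg12.
  by rewrite -sgr_lt0 sg12 sgr_lt0.
- move=> T1 T2 _ /andP[/bipoly_of_term[P1 P1E] /bipoly_of_term[P2 P2E]].
  exists [:: P1 - P2] => t s s' /(_ _ (mem_head _ _)).
  rewrite !hornerD !hornerN !P1E !P2E -!(subr_le0 _ P1.[_].[_]) => sg12.
  by rewrite -sgr_le0 sg12 sgr_le0.
- move=> F1 ih1 F2 ih2 /andP[q1 q2] /andP[r1 r2].
  have [Ps1 E1] := ih1 q1 r1; have [Ps2 E2] := ih2 q2 r2.
  exists (Ps1 ++ Ps2) => t s s' E.
  by rewrite (E1 t s s') ?(E2 t s s') // => P PP; apply: E; rewrite mem_cat PP ?orbT.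
- move=> F1 ih1 F2 ih2 /andP[q1 q2] /andP[r1 r2].
  have [Ps1 E1] := ih1 q1 r1; have [Ps2 E2] := ih2 q2 r2.
  exists (Ps1 ++ Ps2) => t s s' E.
  by rewrite (E1 t s s') ?(E2 t s s') // => P PP; apply: E; rewrite mem_cat PP ?orbT.
- move=> F1 ih1 F2 ih2 /andP[q1 q2] /andP[r1 r2].
  have [Ps1 E1] := ih1 q1 r1; have [Ps2 E2] := ih2 q2 r2.
  exists (Ps1 ++ Ps2) => t s s' E.
  by rewrite (E1 t s s') ?(E2 t s s') // => P PP; apply: E; rewrite mem_cat PP ?orbT.
- move=> F1 ih1 q1 r1; have [Ps1 E1] := ih1 q1 r1.
  by exists Ps1 => t s s' E; rewrite (E1 t s s').
Qed.

(** A semialgebraic subset of the plane is a union of sign classes, by quantifier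
    elimination. *)
Lemma sign_determined_formula (R : realType) (F : QE.formula R) :
  QE.rformula F ->
  exists Ps, sign_determined (fun t s => QE.holds [:: t; s] F) Ps.
Proof.
move=> rF.
have /andP[qG rG] := QE.quantifier_elim_wf (@qe_rcf.wf_QE_wproj R) rF.
have GP e := QE.quantifier_elim_rformP (@qe_rcf.wf_QE_wproj R)
  (@qe_rcf.valid_QE_wproj R) e rF.
have [Ps PsE] := sign_determined_qf qG rG; exists Ps => t s s' sgE.
by move=> /GP h; apply/GP; rewrite -(PsE t s s').
Qed.

Lemma sign_determined_sublevel (R : realType) (n m : nat) (f : mpoly n R)
    (g : 'I_m -> mpoly n R) (b : R) :
  exists Ps, sign_determined (fun t s =>
    exists x, (forall i, pfun (g i) x <= t) /\ pfun f x <= b - s) Ps.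
Proof.
have [Tf rTf TfE] := term_of_mpoly f 2.
have /fin_all_exists2[Tg rTg TgE] := fun i => term_of_mpoly (g i) 2.
pose G s : QE.formula R := foldr (fun i => QE.And (QE.Le (Tg i) (GRing.Var R 0)))
  (QE.Bool true) s.
pose F0 := QE.And (G (enum 'I_m))
  (QE.Le Tf (GRing.Add (GRing.Const b) (GRing.Opp (GRing.Var R 1)))).
pose F := foldr (@QE.Exists R) F0 (iota 2 n).
have rF : QE.rformula F.
  rewrite /F; elim: (iota 2 n) => //=; rewrite rTf !andbT.
  by elim: (enum _) => //= i s ->; rewrite rTg.
have holdsG e s : QE.holds e (G s) <->
    forall i, i \in s -> meval (fun j : 'I_n => e`_(2 + j)) (g i) <= e`_0.
  elim: s => [|i s ih] /=; first by split.
  rewrite TgE; split=> [[gi /ih gs] j|gs].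
    by rewrite inE => /predU1P[->//|/gs].
  split; first by apply: gs; rewrite mem_head.
  by apply/ih => j js; apply: gs; rewrite inE js orbT.
have holdsF t s : QE.holds [:: t; s] F <->
    exists x, (forall i, pfun (g i) x <= t) /\ pfun f x <= b - s.
  rewrite /F holds_exists_block; split.
    move=> [e ee [/holdsG eG]] /=; rewrite TfE !ee // => ef.
    have rowE h : pfun h (\row_j e`_(2 + j)) = meval (fun j : 'I_n => e`_(2 + j)) h.
      by apply: meval_eq => j; rewrite mxE.
    exists (\row_j e`_(2 + j)); rewrite rowE; split=> // i; rewrite rowE.
    by have := eG i (mem_enum _ i); rewrite ee.
  move=> [x [gx fx]]; exists [:: t, s & [seq x ord0 j | j <- enum 'I_n]].
    move=> [|[|i]] //= ni; rewrite nth_nil nth_default // size_map size_enum_ord.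
    by move: ni; rewrite add2n !ltnS -leqNgt.
  have xE h : meval (fun j : 'I_n =>
      [:: t, s & [seq x ord0 j | j <- enum 'I_n]]`_(2 + j)) h = pfun h x.
    apply: meval_eq => j /=; rewrite add0n (nth_map j) ?size_enum_ord //.
    by rewrite nth_ord_enum.
  by split; [apply/holdsG => i _|rewrite /= TfE]; rewrite xE.
have [Ps PsE] := sign_determined_formula rF; exists Ps => t s s' sgE.
by move=> /holdsF h; apply/holdsF; apply: PsE h.
Qed.

Lemma bounded_poly01 (R : realType) (p : {poly R}) :
  exists2 B : R, 0 <= B & forall s, 0 <= s -> s <= 1 -> `|p.[s]| <= B.
Proof.
elim/poly_ind: p => [|p c [B B0 pB]].
  by exists 0 => // s _ _; rewrite horner0 normr0.
exists (B + `|c|) => [|s s0 s1]; first by rewrite addr_ge0.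
rewrite !hornerE; apply: le_trans (ler_normD _ _) _; rewrite lerD2r normrM.
rewrite (ger0_norm s0) -[leRHS]mulr1; apply: ler_pM => //; exact: pB.
Qed.

Lemma bounded_bipoly01 (R : realType) (P : {poly {poly R}}) :
  exists2 B : R, 0 <= B & forall t s, 0 <= t -> t <= 1 -> 0 <= s -> s <= 1 ->
    `|P.[t%:P].[s]| <= B.
Proof.
elim/poly_ind: P => [|P p [B B0 PB]].
  by exists 0 => // t s _ _ _ _; rewrite !horner0 normr0.
have [C C0 pC] := bounded_poly01 p.
exists (B + C) => [|t s t0 t1 s0 s1]; first by rewrite addr_ge0.
rewrite hornerMXaddC hornerD hornerM hornerC.
apply: le_trans (ler_normD _ _) _; apply: lerD; last exact: pC.
rewrite normrM (ger0_norm t0) -[leRHS]mulr1; apply: ler_pM => //; exact: PB.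
Qed.

Lemma poly_lower_bound_at0 (R : realType) (p : {poly R}) : p != 0 ->
  exists (c : R) (N : nat) (d : R), [/\ 0 < c, 0 < d &
    forall s, 0 < s -> s < d -> c * s ^+ N <= `|p.[s]|].
Proof.
move=> p0; have [N [q]] := multiplicity_XsubC p 0; rewrite p0 /= => q0 ->.
have /factor_theorem[r rE] : root (q - q.[0]%:P) 0 by rewrite /root !hornerE subrr.
have {}q0 : 0 < `|q.[0]| by rewrite normr_gt0.
have [B B0 rB] := bounded_poly01 r.
set a := `|q.[0]| in q0 *.
have B1 : 0 < 2 * (B + 1) by lra.
exists (a / 2), N, (Num.min 1 (a / (2 * (B + 1)))); split.
- by rewrite divr_gt0.
- by rewrite lt_min ltr01 divr_gt0.
move=> s s0; rewrite lt_min ltr_pdivlMr // => /andP[s1 sd].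
have sN : 0 <= s ^+ N := exprn_ge0 N (ltW s0).
rewrite !hornerE subr0 normrM (ger0_norm sN).
apply: ler_wpM2r => //.
have qsE : q.[0] = q.[s] - r.[s] * s.
  have := congr1 (fun z => z.[s]) rE; rewrite !hornerE subr0 => <-; ring.
have := rB s (ltW s0) (ltW s1) => rs.
have : a <= `|q.[s]| + `|r.[s]| * s.
  rewrite /a qsE (le_trans (ler_normB _ _)) // normrM (ger0_norm (ltW s0)).
  exact: lexx.
have := ler_wpM2r (ltW s0) rs; nra.
Qed.

(** After division by the largest possible power of [t], the polynomial
    [P (0, s)] is not zero, hence at least [c * s ^ N] near [0].  It differs from
    [P (t, s)] by a multiple of [t], so that a zero of [P] compares [s ^ N]
    with [t]. *)
Lemma bipoly_root_bound (R : realType) (P : {poly {poly R}}) : P != 0 ->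
  exists (C : R) (N : nat) (d : R), [/\ 0 < C, 0 < d &
    forall t s, 0 < t -> t < d -> 0 < s -> s < d -> P.[t%:P].[s] = 0 ->
    s ^+ N.+1 <= C * t].
Proof.
move=> P0; have [k [Q]] := multiplicity_XsubC P 0; rewrite P0 /= => Q0 ->.
have /factor_theorem[G GE] : root (Q - Q.[0]%:P) 0 by rewrite /root !hornerE subrr.
have [c [N [d [c0 d0 low]]]] := poly_lower_bound_at0 Q0.
have [B B0 GB] := bounded_bipoly01 G.
exists (B / c + 1), N, (Num.min 1 d); split.
- by rewrite ltr_wpDl // divr_ge0 // ltW.
- by rewrite lt_min ltr01.
move=> t s t0; rewrite !lt_min => /andP[t1 td] s0 /andP[s1 sd].
rewrite hornerM horner_exp !hornerE subr0 => /eqP.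
rewrite mulf_eq0 expf_eq0 (gt_eqF t0) andbF orbF => /eqP Qts.
have := congr1 (fun z => z.[t%:P].[s]) GE.
rewrite /= hornerD hornerN hornerC hornerD hornerN Qts hornerM hornerM.
rewrite hornerD hornerX hornerN hornerC subr0 hornerC sub0r => Q0s.
have := low s s0 sd; rewrite -normrN Q0s normrM (ger0_norm (ltW t0)) => h1.
have h2 := ler_wpM2r (ltW t0) (GB t s (ltW t0) (ltW t1) (ltW s0) (ltW s1)).
have h3 : s ^+ N <= B / c * t.
  by rewrite mulrAC ler_pdivlMr // mulrC; lra.
have h4 : s ^+ N.+1 <= s ^+ N by rewrite exprS ler_piMl ?(ltW s1) // exprn_ge0 ?(ltW s0).
lra.
Qed.

Lemma bipolys_root_bound (R : realType) (Ps : seq {poly {poly R}}) :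
  exists (C : R) (N : nat) (d : R), [/\ 0 < C, 0 < d &
    forall P, P \in Ps -> P != 0 ->
    forall t s, 0 < t -> t < d -> 0 < s -> s < d -> P.[t%:P].[s] = 0 ->
    s ^+ N.+1 <= C * t].
Proof.
elim: Ps => [|P Ps [C [N [d [C0 d0 Psb]]]]]; first by exists 1, 0%N, 1.
have [P0|P0] := eqVneq P 0.
  by exists C, N, d; split => // Q; rewrite inE => /predU1P[->|/Psb//]; rewrite P0 eqxx.
have [C' [N' [d' [C'0 d'0 Pb]]]] := bipoly_root_bound P0.
exists (C + C'), (N + N')%N, (Num.min 1 (Num.min d d')); split.
- by rewrite addr_gt0.
- by rewrite !lt_min ltr01 d0.
move=> Q QPs Q0 t s t0; rewrite !lt_min => /and3P[t1 td td'] s0 /and3P[s1 sd sd'] QE.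
have low K L : (K <= L)%N -> s ^+ L.+1 <= s ^+ K.+1.
  by move=> KL; apply: ler_wiXn2l; rewrite ?(ltW s0) ?(ltW s1).
have Ct := mulr_gt0 C0 t0; have C't := mulr_gt0 C'0 t0; rewrite mulrDl.
move: QPs; rewrite inE => /predU1P[QP|QPs].
  have := Pb t s t0 td' s0 sd'; rewrite -QP => /(_ QE).
  have := low N' (N + N')%N (leq_addl _ _); lra.
have := Psb Q QPs Q0 t s t0 td s0 sd QE.
have := low N (N + N')%N (leq_addr _ _); lra.
Qed.

Lemma sg_horner_near (R : realType) (p : {poly R}) (a : R) : p.[a] != 0 ->
  \forall s \near a, Num.sg p.[s] = Num.sg p.[a].
Proof.
have pc := @continuous_horner R p a.
rewrite neq_lt => /orP[pa|pa].
  by near=> s; rewrite !ltr0_sg //; near: s; exact: (cvgr_lt _ pc).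
by near=> s; rewrite !gtr0_sg //; near: s; exact: (cvgr_gt _ pc).
Unshelve. all: by end_near. Qed.

(** Zero polynomials are harmless: their sign is constant. *)
Lemma sg_bipolys_near (R : realType) (Ps : seq {poly {poly R}}) (t a : R) :
  (forall P, P \in Ps -> P != 0 -> P.[t%:P].[a] != 0) ->
  \forall s \near a, forall P, P \in Ps ->
    Num.sg P.[t%:P].[a] = Num.sg P.[t%:P].[s].
Proof.
elim: Ps => [|P Ps ih] Pa; first by near=> s.
have Psa : forall Q, Q \in Ps -> Q != 0 -> Q.[t%:P].[a] != 0.
  by move=> Q QPs; apply: Pa; rewrite inE QPs orbT.
have : \forall s \near a, Num.sg P.[t%:P].[a] = Num.sg P.[t%:P].[s].
  have [->|P0] := eqVneq P 0; first by near=> s; rewrite !horner0.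
  near=> s; apply/esym; near: s; apply: sg_horner_near.
  by apply: Pa; rewrite ?mem_head.
move: (ih Psa); apply: filterS2 => s sPs sP Q.
by rewrite inE => /predU1P[->//|/sPs].
Unshelve. all: by end_near. Qed.

(** For fixed [t], let [sup A] be the largest possible value of [b - f] on the
    sublevel set.  Membership in [A] changes at [sup A], so that one of the
    polynomials that determine it vanishes there; since [sup A] tends to [0] with
    [t], a power of it is at most a multiple of [t]. *)
Lemma holder_sublevel (R : realType) (n m : nat) (f : mpoly n R)
    (g : 'I_m -> mpoly n R) (b : R) :
  (forall eta, 0 < eta -> exists2 tau : R, 0 < tau & forall x,
     (forall i, pfun (g i) x <= tau) -> b - eta <= pfun f x) ->
  exists (C : R) (N : nat) (d : R), [/\ 0 < C, 0 < d &
    forall t x, 0 < t -> t < d -> (forall i, pfun (g i) x <= t) ->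
    pfun f x < b -> (b - pfun f x) ^+ N.+1 <= C * t].
Proof.
move=> lim; have [Ps PsE] := sign_determined_sublevel f g b.
have [C [N [d [C0 d0 PsC]]]] := bipolys_root_bound Ps.
have [|tau tau0 tauE] := lim (d / 2); first by rewrite divr_gt0.
exists C, N, (Num.min tau d); split; rewrite ?lt_min ?tau0 //.
move=> t x t0; rewrite lt_min => /andP[ttau td] gx fx.
pose A := [set s : R | exists y, (forall i, pfun (g i) y <= t) /\ pfun f y <= b - s].
have Ax : A (b - pfun f x) by exists x; split => //; lra.
have Aub : ubound A (d / 2).
  move=> s [y [gy fy]]; have := tauE y (fun i => le_trans (gy i) (ltW ttau)).
  lra.
have supA : has_sup A by split; [exists (b - pfun f x)|exists (d / 2)].
have sup_ge : b - pfun f x <= sup A by exact: sup_upper_bound.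
have sup_lt : sup A < d.
  by have := ge_sup (ex_intro _ _ Ax) Aub; lra.
have sup0 : 0 < sup A by lra.
suff [P PPs [P0 Psup]] : exists2 P, P \in Ps & P != 0 /\ P.[t%:P].[sup A] = 0.
  apply: le_trans (PsC P PPs P0 t _ t0 td sup0 sup_lt Psup).
  by apply: lerXn2r; rewrite ?nnegrE; lra.
apply: contrapT => noroot.
have /sg_bipolys_near[e /= e0 sgE] :
    forall P, P \in Ps -> P != 0 -> P.[t%:P].[sup A] != 0.
  move=> P PPs P0; apply/eqP => PA; apply: noroot; exists P => //.
have [s As sA] := sup_adherent e0 supA.
have sup_s := sup_upper_bound supA As.
have Asup : A (sup A).
  apply: PsE As => P PPs; apply/esym/sgE => //.
  by rewrite /= ger0_norm; lra.
have : A (sup A + e / 2).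
  apply: PsE Asup => P PPs; apply: sgE => //=.
  by rewrite ler0_norm; lra.
by move=> /(sup_upper_bound supA); lra.
Qed.

(** * Exact penalization *)

Lemma violation_ge0 (R : realType) (n m : nat) (g : 'I_m -> mpoly n R) x :
  0 <= violation g x.
Proof. exact: bigmax_ge_id. Qed.

Lemma violation_leP (R : realType) (n m : nat) (g : 'I_m -> mpoly n R) x (t : R) :
  0 <= t -> violation g x <= t <-> forall i, pfun (g i) x <= t.
Proof.
move=> t0; split=> [/bigmax_leP[_ h] i|h]; first exact: h.
by apply/bigmax_leP; split=> // i _; exact: h.
Qed.

Lemma feasibleP (R : realType) (n m : nat) (g : 'I_m -> mpoly n R) x :
  feasible g x <-> violation g x = 0.
Proof.
split=> [gx|gx i]; last first.
  by apply: (violation_leP g x (lexx 0)).1; rewrite gx.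
by apply/eqP; rewrite eq_le violation_ge0 andbT; exact/violation_leP.
Qed.

Lemma einf_gtNy (R : realType) (T : Type) (D : set T) (phi : T -> R) :
  (-oo < einf D phi)%E <-> exists B : R, forall x, D x -> B <= phi x.
Proof.
split=> [|[B BD]].
  case E : (einf D phi) => [r| |] // _.
    exists r => x Dx; rewrite -lee_fin -E; apply: ereal_inf_lbound.
    by exists x.
  exists 0 => x Dx; have : (einf D phi <= (phi x)%:E)%E.
    by apply: ereal_inf_lbound; exists x.
  by rewrite E.
apply: (@lt_le_trans _ _ B%:E); first exact: ltNyr.
by apply: le_ereal_inf_tmp => _ [x Dx <-]; rewrite lee_fin; exact: BD.
Qed.

Lemma einf_argmin (R : realType) (T : Type) (D : set T) (phi : T -> R) x :
  argmin D phi x -> einf D phi = (phi x)%:E.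
Proof.
move=> [Dx xmin]; apply/eqP; rewrite eq_le; apply/andP; split.
  by apply: ereal_inf_lbound; exists x.
by apply: le_ereal_inf_tmp => _ [y Dy <-]; rewrite lee_fin; exact: xmin.
Qed.

Lemma einf_le (R : realType) (T : Type) (D : set T) (phi : T -> R) (r : R) x :
  einf D phi = r%:E -> D x -> r <= phi x.
Proof.
by move=> E Dx; rewrite -lee_fin -E; apply: ereal_inf_lbound; exists x.
Qed.

Lemma einf_approx (R : realType) (T : Type) (D : set T) (phi : T -> R) (r d : R) :
  einf D phi = r%:E -> 0 < d -> exists2 x, D x & phi x <= r + d.
Proof.
move=> E d0; have : (einf D phi < (r + d)%:E)%E by rewrite E lte_fin ltrDl.
move=> /ereal_inf_lt[_ [x Dx <-]]; rewrite lte_fin => /ltW xd.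
by exists x.
Qed.

Lemma feasible_sublevel (R : realType) (n m : nat) (f : mpoly n R)
    (g : 'I_m -> mpoly n R) (L : R) :
  convenient (fcons f g) -> nondegenerate_at_infinity (fcons f g) ->
  (forall d, 0 < d -> exists x, pfun f x <= L + d /\ forall i, pfun (g i) x <= d) ->
  exists2 x, feasible g x & pfun f x <= L.
Proof.
move=> Fconv Fnd approx.
have fconsP (P : mpoly n R -> R -> Prop) :
    (forall i, P (fcons f g i) (fcons L (fun=> 0) i)) <->
    P f L /\ forall i, P (g i) 0.
  split=> [h|[Pf Pg] i].
    split; first by have := h ord0; rewrite /fcons unlift_none.
    by move=> i; have := h (lift ord0 i); rewrite /fcons liftK.
  by rewrite /fcons; case: unliftP => [j|] _.
have [d d0|x /(fconsP (fun h c => pfun h x <= c))[fx gx]] :=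
  sublevel_attained (c := fcons L (fun=> 0)) Fconv Fnd.
  have [x [fx gx]] := approx d d0; exists x.
  apply/(fconsP (fun h c => pfun h x <= c + d)); split=> // i.
  by rewrite add0r.
by exists x.
Qed.

Lemma le_powR_invS (R : realType) (a b : R) (N : nat) : 0 <= a ->
  a ^+ N.+1 <= b -> a <= b `^ (N.+1%:R^-1).
Proof.
move=> a0 ab.
have -> : a = (a ^+ N.+1) `^ (N.+1%:R^-1).
  by rewrite -powR_mulrn // -powRrM divff ?pnatr_eq0 // powRr1.
by rewrite ge0_ler_powR // nnegrE ?exprn_ge0 // (le_trans _ ab) // exprn_ge0.
Qed.

Lemma powR_le1D (R : realType) (a alpha : R) : 0 <= a -> 0 < alpha -> alpha <= 1 ->
  a `^ alpha <= 1 + a.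
Proof.
move=> a0 alpha0 alpha1; have [a1|/ltW a1] := leP a 1.
  have := ge0_ler_powR (ltW alpha0) (_ : a \is Num.nneg) (_ : 1 \is Num.nneg) a1.
  by rewrite !nnegrE powR1 => /(_ a0 ler01) /le_trans; apply; rewrite lerDl.
by rewrite (le_trans (ler1_powR a1 alpha1)) // lerDr.
Qed.

Theorem theorem6p2 (R : realType) (n m : nat) (f : mpoly n R)
    (g : 'I_m -> mpoly n R)
    (hmn : (m + 1 <= n)%N)
    (hS : feasible g !=set0)
    (hinf : einf (feasible g) (pfun f) \is a fin_num)
    (hconv : convenient (fcons f g))
    (hnondeg : nondegenerate_at_infinity (fcons f g)) :
  ((exists cstar alpha : R, exact_penalty f g cstar alpha) <->
   (exists2 cstar : R, 0 < cstar &
      (-oo < einf setT (fun x => pfun f x + cstar * violation g x)%R)%E)) /\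
  (forall cstar alpha : R, exact_penalty f g cstar alpha ->
   forall c : R, cstar < c ->
     argmin (feasible g) (pfun f) = argmin setT (penalized f g c alpha) /\
     argmin (feasible g) (pfun f) !=set0).
Proof.
have [r rE] : exists r, einf (feasible g) (pfun f) = r%:E.
  by exists (fine (einf (feasible g) (pfun f))); rewrite fineK.
have fr x : feasible g x -> r <= pfun f x by exact: einf_le rE.
have [x0 x0S fx0] : exists2 x, feasible g x & pfun f x <= r.
  apply: feasible_sublevel => // d d0; have [x xS fx] := einf_approx rE d0.
  by exists x; split=> // i; rewrite (le_trans (xS i)) // ltW.
have x0min : argmin (feasible g) (pfun f) x0.
  by split=> // y /fr; exact: le_trans.
have fx0r : pfun f x0 = r by apply/eqP; rewrite eq_le fx0 fr.
have lim eta : 0 < eta -> exists2 tau : R, 0 < tau & forall x,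
    (forall i, pfun (g i) x <= tau) -> r - eta <= pfun f x.
  move=> eta0; apply: contrapT => nolim.
  have [d d0|x xS fx] := @feasible_sublevel R n m f g (r - eta) hconv hnondeg.
    apply: contrapT => nox; apply: nolim; exists d => // x gx.
    rewrite leNgt; apply/negP => fx; apply: nox; exists x; split=> //.
    by rewrite ltW // (lt_trans fx) // ltrDl.
  by have := fr x xS; lra.
have pen_feasible c alpha x : 0 < alpha -> feasible g x ->
    penalized f g c alpha x = pfun f x.
  move=> alpha0 /feasibleP; rewrite /penalized => ->.
  by rewrite powR0 ?gt_eqF // addr0 mulr0 addr0.
have psi0 x := violation_ge0 g x.
split; last first.
  move=> cs alpha [cs0 alpha0 alpha1 exact] c csc.
  have pen_ge c' x : cs < c' -> r <= penalized f g c' alpha x.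
    by move=> /exact[penE _]; apply: (einf_le (D := setT)) => //; rewrite -penE.
  split; last by exists x0.
  apply/seteqP; split=> x [].
    move=> xS xmin; split=> // y _; rewrite pen_feasible //.
    by apply: le_trans (xmin x0 x0S) _; rewrite fx0r pen_ge.
  move=> _ xmin; have penx : penalized f g c alpha x <= r.
    by have := xmin x0 I; rewrite (pen_feasible c alpha x0) // fx0r.
  (* Comparison with a smaller admissible constant forces the violation to
     vanish. *)
  have csc' : cs < (cs + c) / 2 by lra.
  have := pen_ge _ x csc'; have := powR_ge0 (violation g x) alpha.
  move: penx; rewrite /penalized; set a := _ `^ _ => penx a0 penx'.
  have psix : violation g x = 0.
    have := psi0 x; nra.
  have xS : feasible g x by apply/feasibleP.
  have ca : 0 <= c * (a + violation g x) by rewrite mulr_ge0 ?addr_ge0 //; lra.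
  by split=> // y /fr; apply: le_trans; lra.
split.
  move=> [cs [alpha [cs0 alpha0 alpha1 exact]]].
  have cs1 : cs < cs + 1 by lra.
  have [_ /einf_gtNy[B BP]] := exact (cs + 1) cs1.
  (* The factor [2] absorbs the term [violation g x] that bounds the power. *)
  exists (2 * (cs + 1)); first by lra.
  apply/einf_gtNy; exists (B - (cs + 1)) => x _.
  have := BP x I; rewrite /penalized; have := powR_le1D (psi0 x) alpha0 alpha1.
  set a := _ `^ _; set b := violation g x => ab; nra.
move=> [c1 c10 /einf_gtNy[B BP]].
have [C [N [d [C0 d0 holder]]]] := holder_sublevel lim.
pose alpha : R := N.+1%:R^-1.
have alpha0 : 0 < alpha by rewrite invr_gt0.
pose K := C `^ alpha; have K0 : 0 <= K := powR_ge0 _ _.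
pose c0 := K + (`|r - B| / d + c1).
have rB0 : 0 <= `|r - B| / d by rewrite divr_ge0 // ltW.
exists c0, alpha; split => //.
- by rewrite /c0; lra.
- by rewrite invf_le1 // ler1n.
rewrite /c0 => c c0c.
have pen_ge x : r <= penalized f g c alpha x.
  rewrite /penalized; have := psi0 x; rewrite le_eqVlt => /predU1P[/esym psix|psix].
    by have /feasibleP/fr := psix; rewrite psix powR0 ?gt_eqF // addr0 mulr0 addr0.
  set a := violation g x `^ alpha; set b := violation g x in psix *.
  have ca : K * a <= c * a by rewrite ler_wpM2r ?powR_ge0 //; lra.
  have cb : (`|r - B| / d + c1) * b <= c * b by rewrite ler_wpM2r ?(ltW psix) //; lra.
  have a0 : 0 <= K * a by rewrite mulr_ge0 ?powR_ge0.
  have b0 : 0 <= `|r - B| / d * b by rewrite mulr_ge0 // ltW.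
  have c1b : 0 <= c1 * b by rewrite mulr_ge0 // ltW.
  (* Where the violation is at least [d], the lower bound [B] of the penalized
     function with exponent [1] suffices, constants being multiples of [b]. *)
  have [bd|db] := ltP b d; last first.
    have h : `|r - B| <= `|r - B| / d * b.
      by rewrite -[leLHS]mulr1 -mulrA ler_wpM2l // ler_pdivlMl // mulr1.
    have := BP x I; rewrite -/b; have := ler_norm (r - B); lra.
  have [fx|fx] := leP r (pfun f x); first by lra.
  have gx : forall i, pfun (g i) x <= b by apply: (violation_leP g x (ltW psix)).1.
  have rf0 : 0 <= r - pfun f x by lra.
  have := le_powR_invS rf0 (holder _ _ psix bd gx fx).
  by rewrite (powRM _ (ltW C0) (ltW psix)) -/alpha -/K -/a; lra.
have pen_x0 : argmin setT (penalized f g c alpha) x0.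
  by split=> // y _; rewrite (pen_feasible c alpha x0) // fx0r.
rewrite rE (einf_argmin pen_x0) pen_feasible // fx0r; split=> //.
exact: ltNyr.
Qed.
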